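(* Suppose that the number $s$ of resources and the number $|\mathcal{T}|$ of distinct job release dates are constants (fixed, not part of the input). Then the problem $1|jrp,r_j|\sum w_jC_j+c_\mathcal{Q}$ is equivalent to the classical single machine scheduling problem $1|r_j|\sum w_jC_j$.
   Context: Problem $1|jrp,r_j|c_S+c_\mathcal{Q}$: a set $\mathcal{J}$ of $n$ jobs must be processed non-preemptively on a single machine that processes at most one job at a time. Job $j$ has processing time $p_j>0$, release date $r_j\ge 0$ and weight $w_j>0$. There are resources $\mathcal{R}=\{R_1,\dots,R_s\}$, and each job $j$ requires a nonempty subset $R(j)\subseteq\mathcal{R}$. There are nonnegative costs $K_0,K_1,\dots,K_s$. A solution is a pair $(S,\mathcal{Q})$, where $S$ assigns a start time $S_j$ to each job (completion time $C_j=S_j+p_j$), and $\mathcal{Q}=\{(\mathcal{R}_1,t_1),\dots,(\mathcal{R}_q,t_q)\}$ is a replenishment structure with time points $t_1<\dots<t_q$ and subsets $\mathcal{R}_\ell\subseteq\mathcal{R}$ (the resources of $\mathcal{R}_\ell$ are replenished at time $t_\ell$). Job $j$ is ready to be started at time $t$ if $R(j)\subseteq\bigcup_{\ell:\,t_\ell\in[r_j,t]}\mathcal{R}_\ell$. The solution is feasible if no two jobs overlap in time and each job $j$ is ready to be started at $S_j$. The replenishment cost is $c_\mathcal{Q}=\sum_{\ell=1}^{q}(K_0+\sum_{R_i\in\mathcal{R}_\ell}K_i)$, and the goal is to minimize $\sum_j w_jC_j+c_\mathcal{Q}$ over feasible solutions. $\mathcal{T}$ denotes the set of distinct values among the release dates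 $r_j$. The problem $1|r_j|\sum w_jC_j$ is: schedule the jobs non-preemptively on a single machine, each job starting no earlier than its release date, minimizing $\sum_j w_jC_j$. Two optimization problems $A$ and $B$ are called equivalent if an optimal solution of $A$ can be obtained in polynomial time using an oracle that solves $B$ optimally in constant time (with the instances passed to the oracle prepared in time polynomial in the size of the instance of $A$), and vice versa. *)

(* Defs.v *)
From HB Require Import structures.
From mathcomp Require Import all_boot all_order all_algebra.
Set Implicit Arguments.
Unset Strict Implicit.
Unset Printing Implicit Defensive.
Import Order.TTheory GRing.Theory Num.Theory.
Local Open Scope ring_scope.

(** * Model of computation

  Algorithms are programs of a WHILE language over S-expressions with rational
  atoms.  Polynomial time in this model is polynomial time on Turing machines:
  - numbers have their binary size, and arithmetic and comparison are charged
    the binary sizes of operands and result (logarithmic cost);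
  - building and taking apart pairs costs one unit (pointer manipulation);
  - since pairs can share subterms, the length of a value written out in full
    is charged when the value is passed to the oracle or output as the result;
  - the oracle itself answers in one unit of time. *)

Inductive data := Nil | Num of rat | Pair of data & data.

Definition bits (m : nat) : nat := (trunc_log 2 m).+1.

Definition rat_size (q : rat) : nat := (bits `|numq q| + bits `|denq q|)%N.

Fixpoint data_size (d : data) : nat :=
  match d with
  | Nil => 1%N
  | Num q => (rat_size q).+1%N
  | Pair a b => (data_size a + data_size b).+1%N
  end.

Inductive binop := Add | Sub | Mul | Div | Le.

Inductive expr :=
  | Var of nat
  | Const of data
  | MkPair of expr & expr
  | Fst of expr
  | Snd of expr
  | IsPair of expr
  | Op of binop & expr & expr.

(* In tests, [Nil] is false and every other value is true. *)
Inductive cmd :=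
  | Skip
  | Assign of nat & expr
  | Seq of cmd & cmd
  | If of expr & cmd & cmd
  | While of expr & cmd
  | Query of nat & expr.

Definition store := nat -> data.

Definition upd (m : store) (x : nat) (d : data) : store :=
  fun y => if y == x then d else m y.

Definition truth (d : data) : bool := if d is Nil then false else true.
Definition of_bool (b : bool) : data := if b then Num 1 else Nil.
Definition to_rat (d : data) : rat := if d is Num q then q else 0.

Definition binop_eval (o : binop) (a b : rat) : data :=
  match o with
  | Add => Num (a + b)
  | Sub => Num (a - b)
  | Mul => Num (a * b)
  | Div => Num (a / b)
  | Le => of_bool (a <= b)
  end.

Fixpoint eval (m : store) (e : expr) : data :=
  match e with
  | Var x => m x
  | Const d => d
  | MkPair e1 e2 => Pair (eval m e1) (eval m e2)
  | Fst e1 => if eval m e1 is Pair a _ then a else Nil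
  | Snd e1 => if eval m e1 is Pair _ b then b else Nil
  | IsPair e1 => of_bool (if eval m e1 is Pair _ _ then true else false)
  | Op o e1 e2 => binop_eval o (to_rat (eval m e1)) (to_rat (eval m e2))
  end.

Fixpoint eval_time (m : store) (e : expr) : nat :=
  match e with
  | Var _ | Const _ => 1%N
  | MkPair e1 e2 => (eval_time m e1 + eval_time m e2).+1%N
  | Fst e1 | Snd e1 | IsPair e1 => (eval_time m e1).+1%N
  | Op o e1 e2 =>
      (eval_time m e1 + eval_time m e2
       + rat_size (to_rat (eval m e1)) + rat_size (to_rat (eval m e2))
       + data_size (eval m (Op o e1 e2))).+1%N
  end.

(* [exec O c m t m']: with oracle [O], running [c] from the store [m]
   terminates after [t] time units in the store [m']. *)
Inductive exec (O : data -> data) : cmd -> store -> nat -> store -> Prop :=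
  | ExecSkip m : exec O Skip m 1%N m
  | ExecAssign m x e :
      exec O (Assign x e) m (eval_time m e).+1%N (upd m x (eval m e))
  | ExecSeq m1 m2 m3 c1 c2 t1 t2 :
      exec O c1 m1 t1 m2 -> exec O c2 m2 t2 m3 ->
      exec O (Seq c1 c2) m1 (t1 + t2).+1%N m3
  | ExecIf m m' e c1 c2 t :
      exec O (if truth (eval m e) then c1 else c2) m t m' ->
      exec O (If e c1 c2) m (eval_time m e + t).+1%N m'
  | ExecWhileEnd m e c :
      ~~ truth (eval m e) -> exec O (While e c) m (eval_time m e).+1%N m
  | ExecWhileStep m1 m2 m3 e c t1 t2 :
      truth (eval m1 e) ->
      exec O c m1 t1 m2 -> exec O (While e c) m2 t2 m3 ->
      exec O (While e c) m1 (eval_time m1 e + t1 + t2).+1%N m3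
  | ExecQuery m x e :
      exec O (Query x e) m (eval_time m e + data_size (eval m e)).+1%N
        (upd m x (O (eval m e))).

(* Input and output are passed in variable 0; [t] includes the time for
   writing out the result. *)
Definition computes (O : data -> data) (c : cmd) (input : data) (t : nat)
    (output : data) : Prop :=
  exists t0 m,
    [/\ exec O c (upd (fun=> Nil) 0%N input) t0 m, m 0%N = output
      & t = (t0 + data_size output)%N].

(** * Optimization problems and their equivalence *)

Record optproblem := OptProblem {
  raw_instance : Type;
  is_instance : raw_instance -> Prop;
  solution : raw_instance -> Type;
  feasible : forall I : raw_instance, solution I -> Prop;
  cost : forall I : raw_instance, solution I -> rat;
  enc_instance : raw_instance -> data;
  enc_solution : forall I : raw_instance, solution I -> data
}.

Definition optimal (A : optproblem) (I : raw_instance A) (x : solution I) :=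
  feasible x /\ forall y : solution I, feasible y -> cost x <= cost y.

Definition encodes_optimal (A : optproblem) (I : raw_instance A) (d : data) :=
  exists2 x : solution I, optimal x & d = enc_solution x.

(* Nothing is assumed about the answers to queries that do not encode an
   instance. *)
Definition solves (A : optproblem) (O : data -> data) : Prop :=
  forall I : raw_instance A, is_instance I ->
    encodes_optimal I (O (enc_instance I)).

Definition poly_reducible (A B : optproblem) : Prop :=
  exists (c : cmd) (a k : nat),
    forall O : data -> data, solves B O ->
    forall I : raw_instance A, is_instance I ->
    exists (t : nat) (d : data),
      [/\ computes O c (enc_instance I) t d,
          (t <= a * data_size (enc_instance I) ^ k + a)%N
        & encodes_optimal I d].

Definition equivalent (A B : optproblem) : Prop :=
  poly_reducible A B /\ poly_reducible B A.

(** * Encodings *)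

Fixpoint enc_list (l : seq data) : data :=
  if l is d :: l' then Pair d (enc_list l') else Nil.

Definition enc_fun (n : nat) (f : 'I_n -> data) : data :=
  enc_list [seq f i | i <- enum 'I_n].

(* A set of resources is the 0/1 list of its characteristic function. *)
Definition enc_set (s : nat) (A : {set 'I_s}) : data :=
  enc_fun (fun i => Num (i \in A)%:R).

(** * The scheduling problems *)

Record jobs := Jobs {
  njobs : nat;
  ptime : 'I_njobs -> rat;
  rdate : 'I_njobs -> rat;
  weight : 'I_njobs -> rat
}.

Definition release_dates (J : jobs) : seq rat :=
  undup [seq rdate j | j <- enum 'I_(njobs J)].

Definition valid_jobs (tau : nat) (J : jobs) : Prop :=
  (forall j : 'I_(njobs J), [/\ 0 < ptime j, 0 <= rdate j & 0 < weight j])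
  /\ (size (release_dates J) <= tau)%N.

Definition schedule (J : jobs) := 'I_(njobs J) -> rat.

Definition completion (J : jobs) (S : schedule J) (j : 'I_(njobs J)) : rat :=
  S j + ptime j.

Definition no_overlap (J : jobs) (S : schedule J) : Prop :=
  forall i j : 'I_(njobs J),
    i != j -> completion S i <= S j \/ completion S j <= S i.

Definition weighted_completion (J : jobs) (S : schedule J) : rat :=
  \sum_(j < njobs J) weight j * completion S j.

Definition enc_job (J : jobs) (j : 'I_(njobs J)) : seq data :=
  [:: Num (ptime j); Num (rdate j); Num (weight j)].

(* 1|r_j|sum w_j C_j, with at most [tau] distinct release dates.  The bound is
   needed here too: for [tau = 1] the joint replenishment problem is solvable in
   polynomial time, while the problem without the bound is strongly NP-hard. *)
Definition classical_problem (tau : nat) : optproblem := {|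
  raw_instance := jobs;
  is_instance := valid_jobs tau;
  solution := schedule;
  feasible := fun J S =>
    no_overlap S /\ forall j : 'I_(njobs J), rdate j <= S j;
  cost := fun J S => weighted_completion S;
  enc_instance := fun J => enc_fun (fun j : 'I_(njobs J) => enc_list (enc_job j));
  enc_solution := fun J S => enc_fun (fun j => Num (S j))
|}.

Record jrp_data (s : nat) := JrpData {
  jrp_jobs :> jobs;
  required : 'I_(njobs jrp_jobs) -> {set 'I_s};
  cost0 : rat;
  res_cost : 'I_s -> rat
}.

Definition valid_jrp (s tau : nat) (I : jrp_data s) : Prop :=
  [/\ valid_jobs tau I,
      forall j : 'I_(njobs I), required j != set0,
      0 <= cost0 I
    & forall i : 'I_s, 0 <= res_cost I i].

Definition replenishment (s : nat) := seq ({set 'I_s} * rat).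

Definition ready (s : nat) (I : jrp_data s) (Q : replenishment s)
    (j : 'I_(njobs I)) (t : rat) : bool :=
  required j \subset \bigcup_(x <- Q | rdate j <= x.2 <= t) x.1.

Definition replenishment_cost (s : nat) (I : jrp_data s)
    (Q : replenishment s) : rat :=
  \sum_(x <- Q) (cost0 I + \sum_(i in x.1) res_cost I i).

(* 1|jrp,r_j|sum w_j C_j + c_Q, with [s] resources and at most [tau] distinct
   release dates. *)
Definition jrp_problem (s tau : nat) : optproblem := {|
  raw_instance := jrp_data s;
  is_instance := valid_jrp tau;
  solution := fun I => (schedule I * replenishment s)%type;
  feasible := fun I x =>
    [/\ no_overlap x.1,
        sorted <%R [seq y.2 | y <- x.2]
      & forall j : 'I_(njobs I), ready x.2 j (x.1 j)];
  cost := fun I x => weighted_completion x.1 + replenishment_cost I x.2;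
  enc_instance := fun I =>
    Pair (enc_fun (fun j : 'I_(njobs I) =>
            enc_list (rcons (enc_job j) (enc_set (required j)))))
         (Pair (Num (cost0 I)) (enc_fun (fun i => Num (res_cost I i))));
  enc_solution := fun I x =>
    Pair (enc_fun (fun j => Num (x.1 j)))
         (enc_list [seq Pair (enc_set y.1) (Num y.2) | y <- x.2])
|}.

(* Main.v *)
From mathcomp Require Import all_boot all_order all_algebra.
From mathcomp Require Import zify lra.
Require Import Defs.
Set Implicit Arguments.
Unset Strict Implicit.
Unset Printing Implicit Defensive.
Import Order.TTheory GRing.Theory Num.Theory.
Local Open Scope ring_scope.

(** Joint replenishment reduces to the classical problem because it is enough to
  replenish at release dates: moving every replenishment back to the latest
  release date before it, and merging those that meet, keeps all jobs ready and
  does not raise the cost.  With [s] resources and at most [tau] dates only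
  boundedly many replenishment structures are left.  Each of them makes job [j]
  available from the first date at which all of [R(j)] has been replenished since
  [r_j]; these dates are again release dates, so they define an instance of the
  classical problem, and the best answer over all structures is optimal.
  Conversely, a classical instance is a joint replenishment instance in which
  replenishing costs nothing.

  Both algorithms are written in a small functional language compiled to
  commands.  The answers of the oracle have polynomial length because in an
  optimal schedule every job starts at its release date or at the completion of
  another job, so every start time is a release date plus a sum of distinct
  processing times. *)

(** Moving a replenishment back from [y] to the latest release date [t <= y] is harmless because
    each [r_j] is itself a release date: [r_j <= y] implies [r_j <= t], so no job loses a
    replenishment. Merging is harmless because [K_0] and all [K_i] are nonnegative.

    The obstacle is the time bound. The oracle is unconstrained outside valid instances, and even
    there only optimality limits the length of an answer. Queries to the classical oracle are
    therefore guarded by the test that every induced date exists. In the converse direction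
    replenishing is free, so an optimal answer may carry an arbitrarily long replenishment
    structure; taking the first component discards it in constant time, and only the schedule is
    written out.

    The constants [s] and [tau] are built into the programs. Each date multiplies the number of
    structures by [2^s + 1], which stays polynomial because the number of dates is fixed. *)

(** * Bit lengths of rationals and weights of values *)

Lemma leq_bits m n : (m <= n)%N -> (bits m <= bits n)%N.
Proof. by move=> le_mn; rewrite ltnS leq_trunc_log. Qed.

Lemma bits_lt m : (m < 2 ^ bits m)%N.
Proof. exact: trunc_log_ltn. Qed.

Lemma bits_le m e : (0 < e)%N -> (m < 2 ^ e)%N -> (bits m <= e)%N.
Proof.
move=> e0 lt_m; rewrite /bits; case: (posnP m) => [->|m0]; first by rewrite trunc_log0.
rewrite -(ltn_exp2l _ _ (isT : 1 < 2)%N).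
by apply: leq_ltn_trans lt_m; apply: trunc_logP.
Qed.

Lemma bitsM m n : (bits (m * n) <= bits m + bits n)%N.
Proof.
apply: bits_le => //; rewrite expnD.
exact: ltn_mul (bits_lt m) (bits_lt n).
Qed.

Lemma bitsD m n : (bits (m + n) <= bits m + bits n)%N.
Proof.
apply: bits_le => //; rewrite expnD.
have := bits_lt m; have := bits_lt n.
have : (1 < 2 ^ bits m)%N by rewrite -{1}(expn0 2) ltn_exp2l.
have : (1 < 2 ^ bits n)%N by rewrite -{1}(expn0 2) ltn_exp2l.
nia.
Qed.

(** With the sum of numerator and denominator, the four terms of [(|n| + |d|) (|n'| + |d'|)] cover
    numerator and denominator of both the sum and the product of two fractions. Height is thus
    submultiplicative for both operations, and its bit length subadditive. *)
Definition height (q : rat) : nat := (`|numq q| + `|denq q|)%N.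

Lemma height_frac (n d : int) : d != 0 -> (height (n%:~R / d%:~R) <= `|n| + `|d|)%N.
Proof.
move=> d0; case: (divqP n d) => [/eqP|k x k0]; first by rewrite (negPf d0).
rewrite /height !abszM leq_add // leq_pmull //; lia.
Qed.

Lemma heightD a b : (height (a + b) <= height a * height b)%N.
Proof.
have e : a + b = (numq a * denq b + numq b * denq a)%:~R / (denq a * denq b)%:~R.
  rewrite -{1}[a]divq_num_den -{1}[b]divq_num_den addf_div ?intr_eq0 ?denq_neq0 //.
  by rewrite rmorphD !rmorphM.
rewrite e; apply: leq_trans (height_frac _ _) _; first by rewrite mulf_neq0 ?denq_neq0.
rewrite /height; nia.
Qed.

Lemma heightM a b : (height (a * b) <= height a * height b)%N.
Proof.
have e : a * b = (numq a * numq b)%:~R / (denq a * denq b)%:~R.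
  rewrite -{1}[a]divq_num_den -{1}[b]divq_num_den mulf_div.
  by rewrite !rmorphM.
rewrite e; apply: leq_trans (height_frac _ _) _; first by rewrite mulf_neq0 ?denq_neq0.
rewrite /height !abszM; nia.
Qed.

Lemma heightN a : height (- a) = height a.
Proof. by rewrite /height numqN denqN abszN. Qed.

Lemma heightV a : (height a^-1 <= height a)%N.
Proof.
case: (eqVneq a 0) => [->|a0]; first by rewrite invr0.
have e : a^-1 = (denq a)%:~R / (numq a)%:~R by rewrite -{1}[a]divq_num_den invf_div.
rewrite e; apply: leq_trans (height_frac _ _) _; first by rewrite numq_eq0.
by rewrite addnC.
Qed.

Definition rat_len (q : rat) : nat := bits (height q).

Lemma rat_lenD a b : (rat_len (a + b) <= rat_len a + rat_len b)%N.
Proof. exact: leq_trans (leq_bits (heightD a b)) (bitsM _ _). Qed.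

Lemma rat_lenM a b : (rat_len (a * b) <= rat_len a + rat_len b)%N.
Proof. exact: leq_trans (leq_bits (heightM a b)) (bitsM _ _). Qed.

Lemma rat_size_le q : (rat_size q <= 2 * rat_len q)%N.
Proof.
have := @leq_bits `|numq q| (height q) (leq_addr _ _).
have := @leq_bits `|denq q| (height q) (leq_addl _ _).
rewrite /rat_size /rat_len; lia.
Qed.

Lemma rat_len_le q : (rat_len q <= rat_size q)%N.
Proof. exact: bitsD. Qed.

(* Unlike [data_size], this size is subadditive under arithmetic, so that
   accumulated sums and products stay small. *)
Fixpoint wt (d : data) : nat :=
  match d with
  | Nil => 1
  | Num q => (rat_len q).+1
  | Pair a b => (wt a + wt b).+1
  end.

Lemma wt_gt0 d : (0 < wt d)%N. Proof. by case: d. Qed.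

Lemma wt_le_size d : (wt d <= data_size d)%N.
Proof. by elim: d => //= [q|a IHa b IHb]; rewrite ltnS ?rat_len_le ?leq_add. Qed.

Lemma size_le_wt d : (data_size d <= 2 * wt d)%N.
Proof. elim: d => //= [q|a IHa b IHb]; last lia; have := rat_size_le q; lia. Qed.

Lemma rat_len_to_rat d : (rat_len (to_rat d) <= wt d)%N.
Proof. by case: d => [|q|a b] //=. Qed.

Lemma wt_binop o a b : (wt (binop_eval o a b) <= (rat_len a + rat_len b).+1)%N.
Proof.
case: o => /=.
- exact: rat_lenD.
- have := rat_lenD a (- b); by rewrite /rat_len heightN.
- exact: rat_lenM.
- have := rat_lenM a b^-1; have : (rat_len b^-1 <= rat_len b)%N := leq_bits (heightV b); lia.
- by case: (a <= b) => //=; have : (0 < rat_len a)%N by []; have : (0 < rat_len b)%N by [];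
    have -> : rat_len 1 = 2 by []; lia.
Qed.

Fixpoint items (d : data) : seq data := if d is Pair a d' then a :: items d' else [::].

Lemma items_enc l : items (enc_list l) = l.
Proof. by elim: l => //= a l ->. Qed.

Lemma size_items d : (size (items d) <= wt d)%N.
Proof. elim: d => //= a _ b IH; lia. Qed.

Lemma wt_items d x : List.In x (items d) -> (wt x <= wt d)%N.
Proof. elim: d => //= a _ b IH [->|/IH]; lia. Qed.

(** * A functional language compiled to commands *)

(* [TVar] is a de Bruijn index; in [TFold l a body] the body sees the current
   item as variable 0 and the accumulator as variable 1. *)
Inductive tm :=
  | TVar of nat
  | TConst of data
  | TPair of tm & tm
  | TFst of tm
  | TSnd of tm
  | TIsPair of tm
  | TOp of binop & tm & tm
  | TLet of tm & tm
  | TIf of tm & tm & tm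
  | TFold of tm & tm & tm
  | TAsk of tm.

Definition dfst (d : data) := if d is Pair a _ then a else Nil.
Definition dsnd (d : data) := if d is Pair _ b then b else Nil.
Definition dispair (d : data) := of_bool (if d is Pair _ _ then true else false).
Definition dop (o : binop) (a b : data) := binop_eval o (to_rat a) (to_rat b).

Fixpoint sem (O : data -> data) (t : tm) (env : seq data) : data :=
  match t with
  | TVar x => nth Nil env x
  | TConst d => d
  | TPair a b => Pair (sem O a env) (sem O b env)
  | TFst a => dfst (sem O a env)
  | TSnd a => dsnd (sem O a env)
  | TIsPair a => dispair (sem O a env)
  | TOp o a b => dop o (sem O a env) (sem O b env)
  | TLet a b => sem O b (sem O a env :: env)
  | TIf a b c => if truth (sem O a env) then sem O b env else sem O c env
  | TFold l a body =>
      foldl (fun acc it => sem O body (it :: acc :: env)) (sem O a env)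
        (items (sem O l env))
  | TAsk a => O (sem O a env)
  end.

Fixpoint fold_cost (f : data -> data -> data) (g : data -> data -> nat)
    (acc : data) (l : seq data) : nat :=
  if l is it :: l' then (g acc it + fold_cost f g (f acc it) l')%N else 0%N.

Definition op_cost o a b : nat :=
  (3 + rat_size (to_rat a) + rat_size (to_rat b) + data_size (dop o a b))%N.

(** The constants count the assignments, sequencings and tests emitted by [compile], so this is the
    exact running time of the compiled command. *)
Fixpoint tcost (O : data -> data) (t : tm) (env : seq data) : nat :=
  match t with
  | TVar x => 2
  | TConst d => 2
  | TPair a b => (tcost O a env + tcost O b env + 6)%N
  | TFst a | TSnd a | TIsPair a => (tcost O a env + 4)%N
  | TOp o a b => (tcost O a env + tcost O b env
                  + op_cost o (sem O a env) (sem O b env) + 3)%N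
  | TLet a b => (tcost O a env + tcost O b (sem O a env :: env) + 4)%N
  | TIf a b c => (tcost O a env + 3 +
       (if truth (sem O a env) then tcost O b env else tcost O c env))%N
  | TFold l a body => (tcost O l env + tcost O a env + 8 +
      fold_cost (fun acc it => sem O body (it :: acc :: env))
        (fun acc it => tcost O body (it :: acc :: env) + 14)%N (sem O a env)
        (items (sem O l env)))%N
  | TAsk a => (tcost O a env + data_size (sem O a env) + 3)%N
  end.

(* [compile t r k] leaves the value of [t] in register [k]; the variables of [t]
   live in the registers [r], all below [k], and only registers from [k] on
   are modified. *)
Fixpoint compile (t : tm) (r : seq nat) (k : nat) : cmd :=
  match t with
  | TVar x => Assign k (nth (Const Nil) [seq Var y | y <- r] x)
  | TConst d => Assign k (Const d)
  | TPair a b =>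
      Seq (compile a r k) (Seq (compile b r k.+1) (Assign k (MkPair (Var k) (Var k.+1))))
  | TFst a => Seq (compile a r k) (Assign k (Fst (Var k)))
  | TSnd a => Seq (compile a r k) (Assign k (Snd (Var k)))
  | TIsPair a => Seq (compile a r k) (Assign k (IsPair (Var k)))
  | TOp o a b =>
      Seq (compile a r k) (Seq (compile b r k.+1) (Assign k (Op o (Var k) (Var k.+1))))
  | TLet a b => Seq (compile a r k) (Seq (compile b (k :: r) k.+1) (Assign k (Var k.+1)))
  | TIf a b c => Seq (compile a r k) (If (Var k) (compile b r k) (compile c r k))
  | TFold l a body =>
      Seq (compile l r k) (Seq (compile a r k.+1) (Seq
        (While (IsPair (Var k))
           (Seq (Assign k.+2 (Fst (Var k))) (Seq (Assign k (Snd (Var k)))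
             (Seq (compile body (k.+2 :: k.+1 :: r) k.+3) (Assign k.+1 (Var k.+3))))))
        (Assign k (Var k.+1))))
  | TAsk a => Seq (compile a r k) (Query k (Var k))
  end.

Lemma upd_eq m x d : upd m x d x = d.
Proof. by rewrite /upd eqxx. Qed.

Lemma upd_neq m x d y : y != x -> upd m x d y = m y.
Proof. by rewrite /upd => /negPf ->. Qed.

Definition below (m m' : store) (k : nat) := forall j, (j < k)%N -> m' j = m j.

Lemma below_trans m1 m2 m3 k l :
  (k <= l)%N -> below m1 m2 k -> below m2 m3 l -> below m1 m3 k.
Proof. by move=> kl b1 b2 j jk; rewrite b2 ?b1 // (leq_trans jk). Qed.

Lemma below_upd m k x d : (k <= x)%N -> below m (upd m x d) k.
Proof. by move=> kx j jk; rewrite upd_neq // neq_ltn (leq_trans jk). Qed.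

Lemma below_map m m' k r : all (fun y => y < k)%N r -> below m m' k ->
  [seq m' y | y <- r] = [seq m y | y <- r].
Proof.
move=> hr bm; elim: r hr => //= y r IH /andP[yk /IH ->]; by rewrite bm.
Qed.

Lemma all_below k l r : (k <= l)%N -> all (fun y => y < k)%N r -> all (fun y => y < l)%N r.
Proof. by move=> kl; apply: sub_all => y yk; apply: leq_trans kl. Qed.

Lemma exec_eq O c m t t' m' : exec O c m t m' -> t = t' -> exec O c m t' m'.
Proof. by move=> h <-. Qed.

Lemma compile_correct O t : forall r k m, all (fun y => y < k)%N r ->
  exists m', [/\ exec O (compile t r k) m (tcost O t [seq m y | y <- r]) m',
                 m' k = sem O t [seq m y | y <- r] & below m m' k].
Proof.
elim: t => /= [x|d|a IHa b IHb|a IHa|a IHa|a IHa|o a IHa b IHb|a IHa b IHb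
  |a IHa b IHb c IHc|l IHl a IHa body IHb|a IHa] r k m hr.
- have [e et] : eval m (nth (Const Nil) [seq Var y | y <- r] x) = nth Nil [seq m y | y <- r] x
    /\ eval_time m (nth (Const Nil) [seq Var y | y <- r] x) = 1%N.
    case: (ltnP x (size r)) => hx; first by rewrite !(nth_map 0%N).
    by rewrite !nth_default ?size_map.
  exists (upd m k (eval m (nth (Const Nil) [seq Var y | y <- r] x))); split.
  + by apply: exec_eq (ExecAssign _ _ _ _) _; rewrite et.
  + by rewrite upd_eq.
  + exact: below_upd.
- exists (upd m k (eval m (Const d))); split; [exact: ExecAssign| |exact: below_upd].
  by rewrite upd_eq.
- have [m1 [e1 v1 b1]] := IHa r k m hr.
  have [m2 [e2 v2 b2]] := IHb r k.+1 m1 (all_below (leqnSn k) hr).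
  have em1 := below_map hr b1; rewrite em1 in e2 v2.
  exists (upd m2 k (eval m2 (MkPair (Var k) (Var k.+1)))); split.
  + apply: exec_eq (ExecSeq e1 (ExecSeq e2 (ExecAssign _ _ _ _))) _ => /=; lia.
  + by rewrite upd_eq /= b2 // v1 v2.
  + exact: below_trans (leqnn k) (below_trans (leqnSn k) b1 b2) (below_upd _ _ (leqnn k)).
- have [m1 [e1 v1 b1]] := IHa r k m hr.
  exists (upd m1 k (eval m1 (Fst (Var k)))); split.
  + apply: exec_eq (ExecSeq e1 (ExecAssign _ _ _ _)) _ => /=; lia.
  + by rewrite upd_eq /= v1.
  + exact: below_trans (leqnn k) b1 (below_upd _ _ (leqnn k)).
- have [m1 [e1 v1 b1]] := IHa r k m hr.
  exists (upd m1 k (eval m1 (Snd (Var k)))); split.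
  + apply: exec_eq (ExecSeq e1 (ExecAssign _ _ _ _)) _ => /=; lia.
  + by rewrite upd_eq /= v1.
  + exact: below_trans (leqnn k) b1 (below_upd _ _ (leqnn k)).
- have [m1 [e1 v1 b1]] := IHa r k m hr.
  exists (upd m1 k (eval m1 (IsPair (Var k)))); split.
  + apply: exec_eq (ExecSeq e1 (ExecAssign _ _ _ _)) _ => /=; lia.
  + by rewrite upd_eq /= v1.
  + exact: below_trans (leqnn k) b1 (below_upd _ _ (leqnn k)).
- have [m1 [e1 v1 b1]] := IHa r k m hr.
  have [m2 [e2 v2 b2]] := IHb r k.+1 m1 (all_below (leqnSn k) hr).
  have em1 := below_map hr b1; rewrite em1 in e2 v2.
  exists (upd m2 k (eval m2 (Op o (Var k) (Var k.+1)))); split.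
  + apply: exec_eq (ExecSeq e1 (ExecSeq e2 (ExecAssign _ _ _ _))) _ => /=.
    rewrite b2 // v1 v2 /op_cost /dop; lia.
  + by rewrite upd_eq /= b2 // v1 v2.
  + exact: below_trans (leqnn k) (below_trans (leqnSn k) b1 b2) (below_upd _ _ (leqnn k)).
- have [m1 [e1 v1 b1]] := IHa r k m hr.
  have hr1 : all (fun y => y < k.+1)%N (k :: r) by rewrite /= leqnn (all_below (leqnSn k) hr).
  have [m2 [e2 v2 b2]] := IHb (k :: r) k.+1 m1 hr1.
  rewrite /= v1 (below_map hr b1) in e2 v2.
  exists (upd m2 k (eval m2 (Var k.+1))); split.
  + apply: exec_eq (ExecSeq e1 (ExecSeq e2 (ExecAssign _ _ _ _))) _ => /=; lia.
  + by rewrite upd_eq /= v2.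
  + exact: below_trans (leqnn k) (below_trans (leqnSn k) b1 b2) (below_upd _ _ (leqnn k)).
- have [m1 [e1 v1 b1]] := IHa r k m hr.
  have em1 := below_map hr b1.
  have [m2 [e2 v2 b2]] := IHb r k m1 hr; have [m3 [e3 v3 b3]] := IHc r k m1 hr.
  rewrite em1 in e2 v2 e3 v3.
  case: ifP => h.
  + exists m2; split=> //; last exact: below_trans (leqnn k) b1 b2.
    apply: exec_eq (ExecSeq e1 (@ExecIf O m1 m2 (Var k) _ _ _ _)) _.
      by rewrite /= v1 h; exact: e2.
    rewrite /=; lia.
  + exists m3; split=> //; last exact: below_trans (leqnn k) b1 b3.
    apply: exec_eq (ExecSeq e1 (@ExecIf O m1 m3 (Var k) _ _ _ _)) _.
      by rewrite /= v1 h; exact: e3.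
    rewrite /=; lia.
- have [m1 [e1 v1 b1]] := IHl r k m hr.
  have [m2 [e2 v2 b2]] := IHa r k.+1 m1 (all_below (leqnSn k) hr).
  have em1 := below_map hr b1; rewrite em1 in e2 v2.
  have b12 := below_trans (leqnSn k) b1 b2.
  have em2 := below_map hr b12.
  have v2' : m2 k = sem O l [seq m y | y <- r] by rewrite b2.
  set env := [seq m y | y <- r] in e1 e2 v1 v2 em1 em2 v2' *.
  set f := fun acc it => sem O body (it :: acc :: env).
  set g := fun acc it => (tcost O body (it :: acc :: env) + 14)%N.
  set W := While _ _.
  (* Induction on the value of the loop register: anything that is not a pair stops the loop, just
     as [items] ignores the tail of a list. *)
  have loop : forall d m0, m0 k = d -> [seq m0 y | y <- r] = env ->
    exists m', [/\ exec O W m0 (fold_cost f g (m0 k.+1) (items d) + 3)%N m',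
      m' k.+1 = foldl f (m0 k.+1) (items d) & below m0 m' k].
    have stop d m0 : ~~ truth (dispair d) -> items d = [::] -> m0 k = d ->
       exists m', [/\ exec O W m0 (fold_cost f g (m0 k.+1) (items d) + 3)%N m',
      m' k.+1 = foldl f (m0 k.+1) (items d) & below m0 m' k].
      move=> hd -> hk; exists m0; split=> //.
      by apply: exec_eq (ExecWhileEnd _ _ _) _ => //=; rewrite hk.
    elim=> [|q|x _ d IHd] m0 hk hm; [exact: stop..|].
    set m3 := upd m0 k.+2 (eval m0 (Fst (Var k))).
    set m4 := upd m3 k (eval m3 (Snd (Var k))).
    have b34 : below m0 m4 k.
      by apply: (below_trans (leqnn k) (below_upd _ _ _) (below_upd _ _ (leqnn k))); lia.
    have hr3 : all (fun y => y < k.+3)%N (k.+2 :: k.+1 :: r).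
      by rewrite /= !ltnS leqnSn leqnn; apply: all_below hr; lia.
    have [m5 [e5 v5 b5]] := IHb _ _ m4 hr3.
    have a1 : m4 k.+2 = x.
      by rewrite /m4 upd_neq; [rewrite /m3 upd_eq /= hk|lia].
    have a2 : m4 k.+1 = m0 k.+1.
      rewrite /m4 /m3 !upd_neq //; lia.
    have a3 : m4 k = d.
      rewrite /m4 upd_eq /= /m3 upd_neq ?hk //; lia.
    rewrite /= a1 a2 (below_map hr b34) hm in e5 v5.
    set m6 := upd m5 k.+1 (eval m5 (Var k.+3)).
    have b46 : below m4 m6 k.
      by apply: (@below_trans _ m5 _ _ k.+1); [lia|move=> j jk; apply: b5; lia|apply: below_upd].
    have b06 : below m0 m6 k by apply: below_trans b34 b46.
    have [||m7 [e7 v7 b7]] := IHd m6.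
    + rewrite /m6 upd_neq ?b5 ?a3 //; lia.
    + by rewrite (below_map hr b06).
    have a6 : m6 k.+1 = f (m0 k.+1) x by rewrite /m6 upd_eq /= v5.
    rewrite a6 in e7 v7.
    exists m7; split=> //; last exact: below_trans b06 b7.
    apply: exec_eq (@ExecWhileStep O m0 m6 m7 _ _ _ _ _ _ e7) _.
    + by rewrite /= hk.
    + exact: ExecSeq (ExecAssign _ _ _ _) (ExecSeq (ExecAssign _ _ _ _) (ExecSeq e5 (ExecAssign _ _ _ _))).
    + rewrite /= /g; lia.
  have [m3 [e3 v3 b3]] := loop _ m2 v2' em2.
  exists (upd m3 k (eval m3 (Var k.+1))); split.
  + apply: exec_eq (ExecSeq e1 (ExecSeq e2 (ExecSeq e3 (ExecAssign _ _ _ _)))) _ => /=.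
    rewrite v2; lia.
  + by rewrite upd_eq /= v3 v2.
  + exact: below_trans (leqnn k) (below_trans (leqnn k) b12 b3) (below_upd _ _ (leqnn k)).
- have [m1 [e1 v1 b1]] := IHa r k m hr.
  exists (upd m1 k (O (eval m1 (Var k)))); split.
  + apply: exec_eq (ExecSeq e1 (ExecQuery _ _ _ _)) _ => /=; rewrite v1; lia.
  + by rewrite upd_eq /= v1.
  + exact: below_trans (leqnn k) b1 (below_upd _ _ (leqnn k)).
Qed.

Definition prog (t : tm) : cmd := Seq (compile t [:: 0%N] 1) (Assign 0 (Var 1)).

Lemma prog_computes O t d :
  computes O (prog t) d (tcost O t [:: d] + 3 + data_size (sem O t [:: d]))%N (sem O t [:: d]).
Proof.
have [m [e v _]] := @compile_correct O t [:: 0%N] 1 (upd (fun=> Nil) 0%N d) isT.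
rewrite /= upd_eq in e v.
exists (tcost O t [:: d] + 3)%N, (upd m 0 (eval m (Var 1))); split=> //.
- apply: exec_eq (ExecSeq e (ExecAssign _ _ _ _)) _ => /=; lia.
Qed.

(** * Polynomial bounds *)

(** Monotonicity allows a bound on an intermediate value to be fed into the next bound; the base
    [n.+1] keeps the power positive at [n = 0]. *)
Definition polybound (p : nat -> nat) : Prop :=
  {homo p : m n / (m <= n)%N} /\ exists a k, forall n, (p n <= a * n.+1 ^ k)%N.

Lemma polybound_const c : polybound (fun=> c).
Proof. by split=> //; exists c, 0%N => n; rewrite muln1. Qed.

Lemma polybound_id : polybound id.
Proof. by split=> //; exists 1%N, 1%N => n; rewrite mul1n. Qed.

Lemma polyboundD p q : polybound p -> polybound q -> polybound (fun n => p n + q n)%N.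
Proof.
move=> [mp [a [k hp]]] [mq [b [l hq]]]; split.
  by move=> m n mn; rewrite leq_add ?mp ?mq.
exists (a + b)%N, (k + l)%N => n; rewrite mulnDl leq_add //.
- by apply: leq_trans (hp n) _; rewrite leq_mul2l leq_pexp2l ?leq_addr ?orbT.
- by apply: leq_trans (hq n) _; rewrite leq_mul2l leq_pexp2l ?leq_addl ?orbT.
Qed.

Lemma polyboundM p q : polybound p -> polybound q -> polybound (fun n => p n * q n)%N.
Proof.
move=> [mp [a [k hp]]] [mq [b [l hq]]]; split.
  by move=> m n mn; rewrite leq_mul ?mp ?mq.
exists (a * b)%N, (k + l)%N => n; rewrite expnD mulnACA.
by rewrite leq_mul.
Qed.

Lemma polybound_comp p q : polybound p -> polybound q -> polybound (fun n => p (q n)).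
Proof.
move=> [mp [a [k hp]]] [mq [b [l hq]]]; split.
  by move=> m n mn; rewrite mp ?mq.
exists (a * b.+1 ^ k)%N, (l * k)%N => n.
apply: leq_trans (hp _) _; rewrite -mulnA leq_mul2l expnM -expnMn; apply/orP; right.
have le_q : ((q n).+1 <= b.+1 * n.+1 ^ l)%N.
  have := hq n; have : (0 < n.+1 ^ l)%N by rewrite expn_gt0.
  nia.
by case: (k) => // e; rewrite leq_exp2r.
Qed.

Ltac polyb := repeat first
  [ assumption | exact: polybound_id | exact: polybound_const
  | apply: polyboundD | apply: polyboundM | apply: polybound_comp ].

Definition wenv (env : seq data) : nat := sumn [seq wt d | d <- env].

Lemma wenv_cons d env : wenv (d :: env) = (wt d + wenv env)%N.
Proof. by []. Qed.

Lemma wt_nth env x : (wt (nth Nil env x) <= (wenv env).+1)%N.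
Proof.
by elim: env x => [|d env IH] [|x] //=; rewrite wenv_cons; [lia|have := IH x; lia].
Qed.

(** Time bounds are relative to such a predicate because the length of an oracle answer is known
    only when the query encodes a valid instance; the predicate records what the environment must
    hold for that. *)
Definition envpred := (data -> data) -> seq data -> Prop.

(* Time and result are bounded by a polynomial in the weight of the
   environment, uniformly in the oracle. *)
Definition ptime_on (P : envpred) (t : tm) : Prop :=
  exists2 p, polybound p & forall O env, P O env ->
    (tcost O t env + wt (sem O t env) <= p (wenv env))%N.

Definition anyenv : envpred := fun _ _ => True.

Lemma ptime_var P x : ptime_on P (TVar x).
Proof.
exists (fun n => n + 3)%N; first by polyb.
move=> O env _ /=; have := wt_nth env x; lia.
Qed.

Lemma ptime_const P d : ptime_on P (TConst d).
Proof. by exists (fun=> 2 + wt d)%N; first by polyb. Qed.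

Lemma ptime_pair P a b : ptime_on P a -> ptime_on P b -> ptime_on P (TPair a b).
Proof.
move=> [p pp hp] [q pq hq]; exists (fun n => p n + q n + 7)%N; first by polyb.
move=> O env H /=; have := hp O env H; have := hq O env H; lia.
Qed.

Lemma wt_dfst d : (wt (dfst d) <= wt d)%N.
Proof. case: d => //= a b; lia. Qed.

Lemma wt_dsnd d : (wt (dsnd d) <= wt d)%N.
Proof. case: d => //= a b; lia. Qed.

Lemma wt_dop o a b : (wt (dop o a b) <= (wt a + wt b).+1)%N.
Proof.
have := wt_binop o (to_rat a) (to_rat b); have := rat_len_to_rat a.
have := rat_len_to_rat b; rewrite /dop; lia.
Qed.

Lemma ptime_fst P a : ptime_on P a -> ptime_on P (TFst a).
Proof.
move=> [p pp hp]; exists (fun n => p n + 4)%N; first by polyb.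
move=> O env H /=; have := hp O env H; have := wt_dfst (sem O a env); lia.
Qed.

Lemma ptime_snd P a : ptime_on P a -> ptime_on P (TSnd a).
Proof.
move=> [p pp hp]; exists (fun n => p n + 4)%N; first by polyb.
move=> O env H /=; have := hp O env H; have := wt_dsnd (sem O a env); lia.
Qed.

Lemma ptime_ispair P a : ptime_on P a -> ptime_on P (TIsPair a).
Proof.
move=> [p pp hp]; exists (fun n => p n + 7)%N; first by polyb.
move=> O env H /=; have := hp O env H.
have : (wt (dispair (sem O a env)) <= 3)%N by case: (sem O a env).
lia.
Qed.

Lemma ptime_op P o a b : ptime_on P a -> ptime_on P b -> ptime_on P (TOp o a b).
Proof.
move=> [p pp hp] [q pq hq]; exists (fun n => 7 * (p n + q n) + 9)%N; first by polyb.
move=> O env H /=; have := hp O env H; have := hq O env H.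
rewrite /op_cost; move: (sem O a env) (sem O b env) => x y.
have := wt_dop o x y; have := size_le_wt (dop o x y).
have := rat_size_le (to_rat x); have := rat_size_le (to_rat y).
have := rat_len_to_rat x; have := rat_len_to_rat y; lia.
Qed.

Lemma ptime_let P P' a b : ptime_on P a ->
  (forall O env, P O env -> P' O (sem O a env :: env)) ->
  ptime_on P' b -> ptime_on P (TLet a b).
Proof.
move=> [p pp hp] hP [q pq hq].
exists (fun n => p n + q (p n + n) + 4)%N; first by polyb.
move=> O env H /=; have := hp O env H; have := hq O _ (hP _ _ H).
rewrite wenv_cons => h1 h2.
have : (q (wt (sem O a env) + wenv env) <= q (p (wenv env) + wenv env))%N by apply: pq.1; lia.
lia.
Qed.

(** Each branch may assume the outcome of the test, which is how a guarded query is known to be a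
    valid instance. *)
Lemma ptime_if P P1 P2 a b c : ptime_on P a ->
  (forall O env, P O env -> truth (sem O a env) -> P1 O env) ->
  (forall O env, P O env -> ~~ truth (sem O a env) -> P2 O env) ->
  ptime_on P1 b -> ptime_on P2 c -> ptime_on P (TIf a b c).
Proof.
move=> [p pp hp] h1 h2 [q pq hq] [r pr hr].
exists (fun n => p n + q n + r n + 3)%N; first by polyb.
move=> O env H /=; have := hp O env H; case: ifP => ht.
- have := hq _ _ (h1 _ _ H ht); lia.
- have := hr _ _ (h2 _ _ H (negbT ht)); lia.
Qed.

Lemma ptime_ask P a : ptime_on P a ->
  (exists2 q, polybound q & forall O env, P O env ->
     (wt (O (sem O a env)) <= q (wt (sem O a env)))%N) ->
  ptime_on P (TAsk a).
Proof.
move=> [p pp hp] [q pq hq].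
exists (fun n => 3 * p n + 3 + q (p n))%N; first by polyb.
move=> O env H /=; have := hp O env H; have := hq O env H.
have := size_le_wt (sem O a env) => h1 h2 h3.
have : (q (wt (sem O a env)) <= q (p (wenv env)))%N by apply: pq.1; lia.
lia.
Qed.

(* The part of the answer that is dropped may be arbitrarily large. *)
Lemma ptime_fst_ask P a : ptime_on P a ->
  (exists2 q, polybound q & forall O env, P O env ->
     (wt (dfst (O (sem O a env))) <= q (wt (sem O a env)))%N) ->
  ptime_on P (TFst (TAsk a)).
Proof.
move=> [p pp hp] [q pq hq].
exists (fun n => 3 * p n + 7 + q (p n))%N; first by polyb.
move=> O env H /=; have := hp O env H; have := hq O env H.
have := size_le_wt (sem O a env) => h1 h2 h3.
have : (q (wt (sem O a env)) <= q (p (wenv env)))%N by apply: pq.1; lia.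
lia.
Qed.

Lemma wt_foldl (f : data -> data -> data) c l a :
  (forall acc it, List.In it l -> (wt (f acc it) <= wt acc + c)%N) ->
  (wt (foldl f a l) <= wt a + size l * c)%N.
Proof.
elim: l a => [|x l IH] a h /=; first lia.
have := IH (f a x) (fun acc it hit => h acc it (or_intror hit)).
have := h a x (or_introl erefl); nia.
Qed.

(* Accumulators may only grow additively: this is what keeps a loop polynomial. *)
Definition additive_on (P : envpred) (b : tm) : Prop :=
  exists2 q, polybound q & forall O env acc it, P O (it :: acc :: env) ->
    (wt (sem O b (it :: acc :: env)) <= wt acc + q (wt it + wenv env))%N.

Lemma ptime_fold_inv (P P' : envpred) (I : (data -> data) -> seq data -> data -> Prop) l a b :
  ptime_on P l -> ptime_on P a ->
  (forall O env, P O env -> I O env (sem O a env)) ->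
  (forall O env acc it, P O env -> I O env acc -> List.In it (items (sem O l env)) ->
     P' O (it :: acc :: env) /\ I O env (sem O b (it :: acc :: env))) ->
  additive_on P' b -> ptime_on P' b -> ptime_on P (TFold l a b).
Proof.
move=> [pl ppl hl] [pa ppa ha] I0 IS [q pq hq] [pb ppb hb].
(* Bound for every intermediate accumulator: the initial value plus one increment per item, where
   both the number of items and the weight of each are at most [pl n]. *)
pose A n := (pa n + pl n * q (pl n + n))%N.
exists (fun n => pl n + pa n + 8 + A n + pl n * (pb (pl n + (A n + n)) + 14))%N.
  by rewrite /A; polyb.
move=> O env H /=; have h1 := hl O env H; have h2 := ha O env H.
set n := wenv env in h1 h2 *.
have hsz := size_items (sem O l env).
have hwt := @wt_items (sem O l env).
have hin : forall it, List.In it (items (sem O l env)) -> List.In it (items (sem O l env)) by [].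
have hI := I0 O env H.
set f := fun acc it => _; set g := fun acc it => _.
(* The induction carries a budget: the current accumulator together with the increments still to
   come stays below [A n]. *)
have key : forall L acc, (forall it, List.In it L -> List.In it (items (sem O l env))) ->
   I O env acc -> (size L <= pl n)%N -> (wt acc + size L * q (pl n + n) <= A n)%N ->
   (fold_cost f g acc L <= size L * (pb (pl n + (A n + n)) + 14))%N /\
   (wt (foldl f acc L) <= wt acc + size L * q (pl n + n))%N.
  elim=> [|x L IH] acc hL hacc sL wA /=; first by split; lia.
  have xin : List.In x (items (sem O l env)) by apply: hL; left.
  have [hP' hI'] := IS O env acc x H hacc xin.
  have wx := hwt _ xin.
  have h3 := hq _ _ _ _ hP'.
  have h4 : (q (wt x + wenv env) <= q (pl n + n))%N by apply: pq.1; rewrite -/n; lia.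
  have h5 := hb _ _ hP'; rewrite !wenv_cons -/n in h5.
  have h6 : (pb (wt x + (wt acc + n)) <= pb (pl n + (A n + n)))%N.
    apply: ppb.1; move: wA => /=; nia.
  have [] := IH (f acc x) (fun it hit => hL it (or_intror hit)) hI'.
  - by move: sL => /=; lia.
  - by move: wA => /=; rewrite /f; lia.
  by rewrite /f /g; split; lia.
have [k1 k2] := key (items (sem O l env)) (sem O a env) hin hI ltac:(lia) ltac:(rewrite /A; nia).
rewrite /A in k1 k2 *; nia.
Qed.

Lemma ptime_fold P l a b : ptime_on P l -> ptime_on P a ->
  additive_on anyenv b -> ptime_on anyenv b -> ptime_on P (TFold l a b).
Proof. by move=> hl ha; apply: (ptime_fold_inv (I := fun _ _ _ => True)) hl ha _ _. Qed.

Fixpoint simple (t : tm) : bool :=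
  match t with
  | TVar _ | TConst _ => true
  | TPair a b | TOp _ a b | TLet a b => simple a && simple b
  | TFst a | TSnd a | TIsPair a => simple a
  | TIf a b c => [&& simple a, simple b & simple c]
  | TFold _ _ _ | TAsk _ => false
  end.

Lemma ptime_simple t P : simple t -> ptime_on P t.
Proof.
elim: t P => //= [x|d|a IHa b IHb|a IHa|a IHa|a IHa|o a IHa b IHb|a IHa b IHb
  |a IHa b IHb c IHc] P.
- by move=> _; apply: ptime_var.
- by move=> _; apply: ptime_const.
- by case/andP=> sa sb; apply: ptime_pair; [apply: IHa|apply: IHb].
- by move=> sa; apply: ptime_fst; apply: IHa.
- by move=> sa; apply: ptime_snd; apply: IHa.
- by move=> sa; apply: ptime_ispair; apply: IHa.
- by case/andP=> sa sb; apply: ptime_op; [apply: IHa|apply: IHb].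
- by case/andP=> sa sb; apply: (@ptime_let _ anyenv); [apply: IHa| |apply: IHb].
- case/and3P=> sa sb sc.
  by apply: (@ptime_if _ anyenv anyenv); [apply: IHa| | |apply: IHb|apply: IHc].
Qed.

Lemma poly_reducible_prog (A B : optproblem) (t : tm) (P : envpred) :
  (forall O I, @solves B O -> @is_instance A I -> P O [:: enc_instance I]) ->
  ptime_on P t ->
  (forall O I, @solves B O -> @is_instance A I ->
     encodes_optimal I (sem O t [:: enc_instance I])) ->
  poly_reducible A B.
Proof.
move=> hP [p pp hp] ht.
case: pp => mp [a [k hk]].
(* The written-out output is at most twice its weight, whence the 2; the power of 2 comes from
   replacing [n.+1] by [2 * n]; the 3 is the final copy to variable 0. *)
exists (prog t), (2 * a * 2 ^ k + 3)%N, k => O hO I hI.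
have := prog_computes O t (enc_instance I); set T := (_ + data_size _)%N => hc.
exists T, (sem O t [:: enc_instance I]); split=> //; last exact: ht.
have := hp _ _ (hP _ _ hO hI); rewrite /T.
move: (sem O t _) => v; rewrite wenv_cons /wenv /= addn0.
set d := enc_instance I => h1.
have h2 := size_le_wt v.
have h3 : (p (wt d) <= a * (2 ^ k * data_size d ^ k))%N.
  apply: leq_trans (mp _ _ (wt_le_size d)) _; apply: leq_trans (hk _) _.
  rewrite leq_mul2l -expnMn; apply/orP; right.
  have le_d : ((data_size d).+1 <= 2 * data_size d)%N.
    have := wt_gt0 d; have := wt_le_size d; lia.
  by case: (k) => // e; rewrite leq_exp2r.
nia.
Qed.

(** * Optimal schedules are short *)

Definition sched_feasible (J : jobs) (S : schedule J) : Prop :=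
  no_overlap S /\ forall j, rdate j <= S j.

Definition sched_optimal (J : jobs) (S : schedule J) : Prop :=
  sched_feasible S /\
  forall S' : schedule J, sched_feasible S' -> weighted_completion S <= weighted_completion S'.

Lemma bigmax_attained (I : finType) (P : pred I) (F : I -> rat) x :
  let M := \big[Order.max/x]_(i | P i) F i in
  [/\ M = x \/ exists2 i, P i & M = F i, x <= M & forall i, P i -> F i <= M].
Proof.
split.
- elim/big_rec: _ => [|i y Pi [->|[k Pk ->]]]; first by left.
  + by rewrite /Order.max; case: ifP => _; [left|right; exists i].
  + by right; rewrite /Order.max; case: ifP => _; [exists k|exists i].
- exact: bigmax_ge_id.
- by move=> i Pi; apply: le_bigmax_cond.
Qed.

(* A job preceded by idle time could be started earlier. *)
Lemma optimal_start (J : jobs) (S : schedule J) :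
  (forall j, 0 < @ptime J j /\ 0 < @weight J j) -> sched_optimal S ->
  forall j, S j = rdate j \/ exists2 i, S i < S j & S j = completion S i.
Proof.
move=> pos [[noS relS] optS] j.
pose P i := (i != j) && (completion S i <= S j).
(* [t] is the earliest start to which [j] can be shifted without passing a job that ends by [S j].
   Since the weight of [j] is positive, [t < S j] would contradict optimality. *)
have := @bigmax_attained _ P (completion S) (rdate j).
set t := \big[_/_]_(_ | _) _ => -[tv rt Ct].
have ct i : S i < completion S i by rewrite ltrDl; case: (pos i).
have tS : t <= S j by case: tv => [->|[i /andP[_ hi] ->]].
have St : t = S j.
  apply/eqP; rewrite eq_le tS leNgt; apply/negP => tlt.
  pose S' : schedule J := fun i => if i == j then t else S i.
  have feas : sched_feasible S'.
    split=> [i k ik|i]; last by rewrite /S'; case: eqP => [->|_].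
    rewrite /completion /S'; case: (eqVneq i j) => ij; case: (eqVneq k j) => kj.
    - by rewrite ij kj eqxx in ik.
    - have kP : completion S k <= S j -> completion S k <= t.
        by move=> h; apply: Ct; rewrite /P kj.
      have [h|h] := noS _ _ ik; rewrite ij in h *; [left|right; exact: kP].
      by apply: le_trans h; rewrite /completion lerD2r ltW.
    - have iP : completion S i <= S j -> completion S i <= t.
        by move=> h; apply: Ct; rewrite /P ij.
      have [h|h] := noS _ _ ik; rewrite kj in h; [left; exact: iP|right].
      by rewrite kj; apply: le_trans h; rewrite /completion lerD2r ltW.
    - exact: noS.
  have := optS _ feas; rewrite leNgt => /negP[].
  rewrite /weighted_completion (bigD1 j) //= [X in _ < X](bigD1 j) //=.
  rewrite (eq_bigr (fun i => weight i * completion S i)); last first.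
    by move=> i /negPf ij; rewrite /completion /S' ij.
  rewrite ltrD2r ltr_pM2l; last by case: (pos j).
  by rewrite /completion /S' eqxx ltrD2r.
case: tv => [e|[i /andP[_ hi] e]]; first by left; rewrite -St.
by right; exists i; [apply: lt_le_trans (ct i) hi|rewrite -St].
Qed.

(** Going back from [j] to the job whose completion it awaits, start times strictly decrease, so
    every processing time is added at most once and the chain ends at a release date. Summing over
    strictly earlier jobs leaves room for the processing time added in the induction step. *)
Lemma rat_len_start (J : jobs) (S : schedule J) :
  (forall j, 0 < @ptime J j /\ 0 < @weight J j) -> sched_optimal S ->
  forall j, (rat_len (S j) <=
    \sum_k rat_len (@rdate J k) + \sum_(k | (S k < S j)%R) rat_len (ptime k))%N.
Proof.
move=> pos opt j; have [n] := ubnP #|[set k | S k < S j]|.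
elim: n j => // n IH j hn.
have [->|[i ij e]] := optimal_start pos opt j.
  apply: leq_trans (leq_addr _ _); rewrite (bigD1 j) //=; exact: leq_addr.
have pr : [set k | S k < S i] \proper [set k | S k < S j].
  apply/properP; split.
    by apply/subsetP => k; rewrite !inE => /lt_trans; apply.
  by exists i; rewrite !inE ?ltxx.
have h1 := IH i (leq_trans (proper_card pr) hn).
rewrite {1}e; apply: leq_trans (rat_lenD _ _) _.
rewrite [X in (_ <= _ + X)%N](bigD1 i) //=.
have h2 : (\sum_(k | (S k < S i)%R) rat_len (ptime k)
   <= \sum_(k | (S k < S j)%R && (k != i)) rat_len (ptime k))%N.
  rewrite [X in (X <= _)%N]big_mkcond [X in (_ <= X)%N]big_mkcond /=.
  apply: leq_sum => k _; case: ifP => // h; rewrite (lt_trans h ij) /=.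
  by case: eqP => // ki; rewrite ki ltxx in h.
move: h1 h2; set a := (\sum_(_ | _ && _) _)%N; set b := (\sum_(_ | _) _)%N; lia.
Qed.

Lemma wt_enc_fun n (f : 'I_n -> data) : wt (enc_fun f) = (1 + \sum_i (wt (f i)).+1)%N.
Proof.
rewrite /enc_fun -big_enum /=; elim: (enum _) => [|i l IH] /=.
  by rewrite big_nil.
by rewrite big_cons IH; lia.
Qed.

Lemma leq_sum_const n (f : 'I_n -> nat) c : (forall i, f i <= c)%N -> (\sum_i f i <= n * c)%N.
Proof.
move=> h; have <- : (\sum_(i < n) c)%N = (n * c)%N by rewrite sum_nat_const card_ord.
exact: leq_sum.
Qed.

Lemma leq_sum_sub n (P : pred 'I_n) (f g : 'I_n -> nat) :
  (forall i, f i <= g i)%N -> (\sum_(i | P i) f i <= \sum_i g i)%N.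
Proof.
by move=> h; rewrite big_mkcond; apply: leq_sum => i _; case: ifP => _ //.
Qed.

Lemma wt_optimal (J : jobs) (S : schedule J) :
  (forall j, 0 < @ptime J j /\ 0 < @weight J j) -> sched_optimal S ->
  forall w, w = wt (enc_fun (fun j : 'I_(njobs J) => enc_list (enc_job j))) ->
  (wt (enc_fun (fun j => Num (S j))) <= 1 + w * (2 * w + 2))%N.
Proof.
move=> pos opt w ew.
have hw : w = (1 + \sum_(j < njobs J)
    (wt (enc_list (enc_job j))).+1)%N by rewrite ew wt_enc_fun.
have hn : (njobs J <= w)%N.
  rewrite hw; apply: leq_trans (leq_addl _ _).
  have {1}<- : (\sum_(i < njobs J) 1)%N = njobs J by rewrite sum_nat_const card_ord muln1.
  exact: leq_sum.
have hr : (\sum_k rat_len (@rdate J k) <= w)%N.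
  by rewrite hw; apply: leq_trans (leq_addl _ _); apply: leq_sum_sub => i /=; lia.
have hp P : (\sum_(k | P k) rat_len (@ptime J k) <= w)%N.
  by rewrite hw; apply: leq_trans (leq_addl _ _); apply: leq_sum_sub => i /=; lia.
rewrite wt_enc_fun leq_add2l.
(* Release dates and processing times contribute at most [w] each to a start time; the [Num] and
   [Pair] nodes account for the 2. *)
apply: leq_trans (leq_sum_const (c := 2 * w + 2) _) _; last by rewrite leq_mul2r hn orbT.
move=> j /=; have := rat_len_start pos opt j; have := hp (fun k => S k < S j); lia.
Qed.

(** * Replenishing only at release dates *)

Lemma in_bigcup_seq (U : Type) (V : finType) (Q : seq U) (P : pred U) (F : U -> {set V}) i :
  reflect (exists x, [/\ List.In x Q, P x & i \in F x]) (i \in \bigcup_(x <- Q | P x) F x).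
Proof.
apply: (iffP idP).
- elim: Q => [|x Q IH]; first by rewrite big_nil inE.
  rewrite big_cons; case: ifP => Px; last by case/IH => y [? ? ?]; exists y; split=> //; right.
  rewrite inE => /orP[h|/IH[y [? ? ?]]]; first by exists x; split=> //; left.
  by exists y; split=> //; right.
- case=> x [+ Px ix]; elim: Q => //= y Q IH [->|/IH h]; rewrite big_cons.
  + by rewrite Px inE ix.
  + by case: ifP => _ //; rewrite inE h orbT.
Qed.

Section Normalise.

Variables (s : nat) (I : jrp_data s).
Hypotheses (K0 : 0 <= cost0 I) (Ki : forall i, 0 <= res_cost I i).

Let c (A : {set 'I_s}) : rat := cost0 I + \sum_(i in A) res_cost I i.

Lemma set_cost_ge0 A : 0 <= c A.
Proof. by rewrite addr_ge0 ?sumr_ge0. Qed.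

Lemma sum_setU_le (A B : {set 'I_s}) :
  \sum_(i in A :|: B) res_cost I i <= \sum_(i in A) res_cost I i + \sum_(i in B) res_cost I i.
Proof.
rewrite big_mkcond [X in _ <= X + _]big_mkcond [X in _ <= _ + X]big_mkcond -big_split.
apply: ler_sum => i _ /=; rewrite inE; have := Ki i.
by case: (i \in A); case: (i \in B) => /=; lra.
Qed.

(** Merging pays [K_0] and each resource cost once instead of repeatedly. With [has P B] the
    right-hand side contains [K_0] at least once. *)
Lemma set_cost_bigcup (B : replenishment s) (P : pred ({set 'I_s} * rat)) : has P B ->
  c (\bigcup_(x <- B | P x) x.1) <= \sum_(x <- B | P x) c x.1.
Proof.
have h2 : forall B', \sum_(i in \bigcup_(x <- B' | P x) x.1) res_cost I i <=
    \sum_(x <- B' | P x) c x.1.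
  elim=> [|y B' IH]; first by rewrite !big_nil big_set0.
  rewrite !big_cons; case: ifP => // _.
  by apply: le_trans (sum_setU_le _ _) _; rewrite /c; have := K0; lra.
elim: B => // x B IH /=; rewrite !big_cons.
case: ifP => //= Px _; rewrite {1}/c.
apply: le_trans (_ : cost0 I + (\sum_(i in x.1) res_cost I i + _) <= _).
  rewrite lerD2l; exact: sum_setU_le.
by rewrite addrA lerD2l.
Qed.

(** [None] means no replenishment at that date, whereas [Some set0] would still incur [K_0]. *)
Definition select (T : seq rat) (A : rat -> option {set 'I_s}) : replenishment s :=
  pmap (fun t => omap (fun B => (B, t)) (A t)) T.

Lemma map_snd_select T A : [seq y.2 | y <- select T A] = [seq t <- T | isSome (A t)].
Proof. by elim: T => //= t T IH; case: (A t) => //= B; rewrite -IH. Qed.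

Lemma in_select T A t B : t \in T -> A t = Some B -> List.In (B, t) (select T A).
Proof.
move=> + hA; elim: T => //= u T IH; rewrite inE => /orP[/eqP <-|/IH h].
  by rewrite hA /=; left.
by case: (A u) => //= D; right.
Qed.

Let latest (T : seq rat) (t y : rat) := (t <= y) && all (fun t' => (t' <= y) ==> (t' <= t)) T.

(** The bound [r <= t] preserves readiness: a replenishment not before a release date [r] of [T] is
    never moved before [r]. *)
Lemma latest_exists T r y : r \in T -> r <= y ->
  exists t, [/\ t \in T, latest T t y & r <= t].
Proof.
move=> rT ry; have := @bigmax_attained 'I_(size T) (fun i => T`_i <= y) (fun i => T`_i) r.
set t := \big[_/_]_(_ | _) _ => -[tv rt ht].
exists t; split=> //.
  by case: tv => [->|[i _ ->]] //; apply: mem_nth.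
apply/andP; split; first by case: tv => [->|[i hi ->]].
apply/allP => u /(nthP 0)[i hi <-]; apply/implyP => h.
exact: (ht (Ordinal hi)).
Qed.

Lemma latest_uniq T t1 t2 y :
  t1 \in T -> t2 \in T -> latest T t1 y -> latest T t2 y -> t1 = t2.
Proof.
move=> h1 h2 /andP[a1 /allP b1] /andP[a2 /allP b2]; apply/eqP; rewrite eq_le.
by rewrite (implyP (b2 _ h1)) ?(implyP (b1 _ h2)).
Qed.

Lemma sum_at_most_one (T : seq rat) (P : pred rat) (x : rat) : uniq T ->
  (forall t1 t2, t1 \in T -> t2 \in T -> P t1 -> P t2 -> t1 = t2) -> 0 <= x ->
  \sum_(t <- T | P t) x <= x.
Proof.
move=> + + x0; elim: T => [|t T IH] /=; first by rewrite big_nil.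
move=> /andP[tT uT] h; rewrite big_cons; case: ifP => Pt; last first.
  by apply: IH => // a b ha hb; apply: h; rewrite inE ?ha ?hb orbT.
rewrite big_seq_cond big1 ?addr0 // => u /andP[uin Pu].
have tu : t = u by apply: h; rewrite // ?inE ?uin ?eqxx ?orbT.
by rewrite tu uin in tT.
Qed.

(* Every replenishment is moved back to the latest release date before it, and
   replenishments that fall on the same date are merged. *)
Lemma normalise (T : seq rat) (S : schedule I) (Q : replenishment s) :
  uniq T -> (forall j, @rdate I j \in T) -> (forall j, ready Q j (S j)) ->
  exists A, (forall j, ready (select T A) j (S j)) /\
            replenishment_cost I (select T A) <= replenishment_cost I Q.
Proof.
move=> uT rT hready.
pose P t (x : {set 'I_s} * rat) := latest T t x.2.
(* A replenishment preceding all dates of [T] has no latest date and disappears; it serves no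
   job. *)
pose A t := if has (P t) Q then Some (\bigcup_(x <- Q | P t x) x.1) else None.
exists A; split.
- move=> j; apply/subsetP => i /(subsetP (hready j))/in_bigcup_seq[x [xQ /andP[h1 h2] ix]].
  have [t [tT tl rt]] := latest_exists (rT j) h1.
  apply/in_bigcup_seq; exists (\bigcup_(x <- Q | P t x) x.1, t); split=> /=.
  + apply: in_select => //; rewrite /A.
    suff -> : has (P t) Q by [].
    elim: (Q) xQ => //= y Q' IH [->|/IH ->]; last by rewrite orbT.
    by rewrite /P tl.
  + by rewrite rt (le_trans _ h2) //; case/andP: tl.
  + by apply/in_bigcup_seq; exists x.
- have -> : replenishment_cost I (select T A) =
     \sum_(t <- T) (if A t is Some B then c B else 0).
    rewrite /replenishment_cost /select; elim: (T) => [|t T' IH] /=; first by rewrite !big_nil.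
    by rewrite [RHS]big_cons -IH; case: (A t) => [B|] /=; rewrite ?big_cons ?add0r.
  (* Double counting: after the exchange of sums, each replenishment is charged for at most one
     date, its latest one. *)
  apply: le_trans (_ : \sum_(t <- T) \sum_(x <- Q | P t x) c x.1 <= _).
    apply: ler_sum => t _; rewrite /A; case: ifP => hP; first exact: set_cost_bigcup.
    by apply: sumr_ge0 => x _; apply: set_cost_ge0.
  rewrite (exchange_big_dep xpredT) //=.
  apply: ler_sum => x _; apply: sum_at_most_one => //; last exact: set_cost_ge0.
  by move=> t1 t2 h1 h2; apply: latest_uniq.
Qed.

End Normalise.

(** * Release dates induced by a replenishment structure *)

Section InducedDates.

Variables (s : nat) (Q : replenishment s) (r : rat) (D : {set 'I_s}).

Definition first_step (i : 'I_s) (acc : option rat) (x : {set 'I_s} * rat) : option rat :=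
  if acc is Some _ then acc
  else if (r <= x.2) && (i \in x.1) then Some x.2 else None.

Definition first_time (i : 'I_s) : option rat := foldl (first_step i) None Q.

(** Running maximum over the required resources of their first replenishment from [r] on; [None]
    records that one of them is never replenished. The recursion follows the program [t_date]. *)
Definition induced_step (n : nat) (o : option rat) : option rat :=
  if o is Some u then
    if insub n is Some i then
      if i \in D then
        if first_time i is Some v then Some (if u <= v then v else u) else None
      else Some u
    else Some u
  else None.

Fixpoint induced_upto (n : nat) : option rat :=
  if n is n'.+1 then induced_step n' (induced_upto n') else Some r.

Hypothesis sortedQ : sorted <%R [seq y.2 | y <- Q].

(** Sortedness of [Q] makes the first matching list entry the earliest in time. *)
Lemma first_timeP i t :
  (exists2 u, first_time i = Some u & u <= t) <->
  exists x, [/\ List.In x Q, r <= x.2 <= t & i \in x.1].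
Proof.
rewrite /first_time.
have fS : forall L u, foldl (first_step i) (Some u) L = Some u by elim.
elim: (Q) (sortedQ) => [|x L IH] /=.
  by move=> _; split=> [[]|[x []]].
move=> sL; have sL' := path_sorted sL.
have [_ IH2] := IH sL'; have IH1 := (IH sL').1.
case: ifP => h.
  rewrite fS; split=> [[u [<-] ut]|[y [yin /andP[ry yt] iy]]].
    by exists x; split; [left|case/andP: h => ->|case/andP: h].
  exists x.2 => //; case: yin => [-> //|yL].
  apply: le_trans yt; apply: ltW.
  move/(order_path_min lt_trans)/allP: sL; apply.
  elim: (L) yL => //= z L' IHL [->|/IHL hz]; by rewrite inE ?eqxx ?hz ?orbT.
split=> [/IH1[y [yL h1 h2]]|[y [[e|yL] h1 h2]]].
- by exists y; split=> //; right.
- by move: h; rewrite e h2; case/andP: h1 => ->.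
- by apply: IH2; exists y.
Qed.

(** Phrased through upper bounds [t], a maximum turns into a conjunction, and [None] is the case
    without an upper bound. *)
Lemma induced_uptoP n t :
  (exists2 u, induced_upto n = Some u & u <= t) <->
  r <= t /\ forall i : 'I_s, (i < n)%N -> i \in D ->
    exists x, [/\ List.In x Q, r <= x.2 <= t & i \in x.1].
Proof.
elim: n => [|n IH] /=.
  by split=> [[u [<-] ut]|[rt _]]; [split|exists r].
rewrite /induced_step; case: (induced_upto n) IH => [u|] IH; last first.
  split=> [[] //|[rt h]]; have [_ IH2] := IH; case: IH2; last by move=> ? [].
  by split=> // i hi; apply: h; rewrite ltnS ltnW.
have stepP : (exists2 v, Some u = Some v & v <= t) -> 
   (forall i : 'I_s, i = n :> nat -> i \in D ->
      exists x, [/\ List.In x Q, r <= x.2 <= t & i \in x.1]) ->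
   r <= t /\ forall i : 'I_s, (i < n.+1)%N -> i \in D ->
    exists x, [/\ List.In x Q, r <= x.2 <= t & i \in x.1].
  move=> /IH[rt h1] h2; split=> // i; rewrite ltnS leq_eqVlt => /orP[/eqP/h2//|/h1//].
have stepN : (r <= t /\ forall i : 'I_s, (i < n.+1)%N -> i \in D ->
    exists x, [/\ List.In x Q, r <= x.2 <= t & i \in x.1]) ->
    (exists2 v, Some u = Some v & v <= t).
  by move=> [rt h]; apply/IH; split=> // i hi; apply: h; rewrite ltnS ltnW.
case: insubP => [i _ ein|nin]; last first.
  split=> [h|//]; apply: stepP => // i ei; by rewrite -ei ltn_ord in nin.
case: ifP => iD; last first.
  split=> [h|//]; apply: stepP => // k ek kD.
  have : k = i by apply: ord_inj; rewrite ek; exact: esym ein.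
  by move=> eki; rewrite -eki kD in iD.
have ft := first_timeP i t; case: (first_time i) ft => [v|] ft; last first.
  split=> [[] //|[rt h]].
  have := h i; rewrite ein => /(_ (leqnn _) iD) /ft[]; by [].
have maxP : (exists2 w, Some (if u <= v then v else u) = Some w & w <= t) <-> u <= t /\ v <= t.
  split=> [[w [<-]]|[ut vt]].
  - by case: (leP u v) => [uv|/ltW uv] h; split=> //; apply: le_trans h.
  - by exists (if u <= v then v else u) => //; case: ifP.
split=> [/maxP[ut vt]|h].
- apply: stepP; first by exists u.
  move=> k ek kD; have -> : k = i by apply: ord_inj; rewrite ek; exact: esym ein.
  by apply/ft; exists v.
- apply/maxP; have [w [<-] ut] := stepN h; split=> //.
  have [_ [//|w' [<-] //]] := ft.
  by have := h.2 i; rewrite ein; apply.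
Qed.

End InducedDates.

Lemma first_time_mem s (Q : replenishment s) r i u :
  first_time Q r i = Some u -> u \in [seq y.2 | y <- Q].
Proof.
rewrite /first_time.
have fS : forall L v, foldl (first_step r i) (Some v) L = Some v by elim.
elim: Q => //= x Q IH; case: ifP => _; first by rewrite fS => -[<-]; rewrite inE eqxx.
by move/IH => h; rewrite inE h orbT.
Qed.

Lemma induced_upto_mem s (Q : replenishment s) r D n u :
  induced_upto Q r D n = Some u -> u \in r :: [seq y.2 | y <- Q].
Proof.
elim: n u => [|n IH] u /=; first by case=> <-; rewrite inE eqxx.
rewrite /induced_step; case: (induced_upto _ _ _ _) IH => // v IH.
case: insubP => [i _ _|_]; last by move/IH.
case: ifP => _; last by move/IH.
case E : (first_time _ _ _) => [w|] // -[<-]; case: ifP => _; last exact: IH.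
by rewrite inE (first_time_mem E) orbT.
Qed.

Definition induced_date s (I : jrp_data s) (Q : replenishment s) (j : 'I_(njobs I)) :=
  induced_upto Q (rdate j) (required j) s.

(** Nonemptiness of [required j] forces a replenishment in the interval from [r_j] to [t], hence
    [r_j <= t]; an empty set would be ready even before the release date. *)
Lemma induced_dateP s (I : jrp_data s) Q j t :
  sorted <%R [seq y.2 | y <- Q] -> @required s I j != set0 ->
  ready Q j t <-> exists2 u, induced_date Q j = Some u & u <= t.
Proof.
move=> sQ hR; rewrite (induced_uptoP (rdate j) (required j) sQ); split.
- move/subsetP=> h; split; last by move=> i _ /h /in_bigcup_seq.
  have [i /h /in_bigcup_seq[x [_ /andP[h1 h2] _]]] := set0Pn _ hR.
  exact: le_trans h2.
- by case=> rt h; apply/subsetP => i iR; apply/in_bigcup_seq; apply: h.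
Qed.

(** * Library of list programs *)

Fixpoint notfree (x : nat) (t : tm) : bool :=
  match t with
  | TVar y => y != x
  | TConst _ => true
  | TPair a b | TOp _ a b => notfree x a && notfree x b
  | TFst a | TSnd a | TIsPair a | TAsk a => notfree x a
  | TLet a b => notfree x a && notfree x.+1 b
  | TIf a b c => [&& notfree x a, notfree x b & notfree x c]
  | TFold l a b => [&& notfree x l, notfree x a & notfree x.+2 b]
  end.

Lemma sem_notfree O t x env env' : notfree x t ->
  (forall y, y != x -> nth Nil env y = nth Nil env' y) -> sem O t env = sem O t env'.
Proof.
elim: t x env env' => //= [y|a IHa b IHb|a IHa|a IHa|a IHa|o a IHa b IHb|a IHa b IHb
  |a IHa b IHb c IHc|l IHl a IHa b IHb|a IHa] x env env'.
- by move=> yx; apply.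
- by case/andP=> ha hb e; rewrite (IHa x _ env') ?(IHb x _ env').
- by move=> ha e; rewrite (IHa x _ env').
- by move=> ha e; rewrite (IHa x _ env').
- by move=> ha e; rewrite (IHa x _ env').
- by case/andP=> ha hb e; rewrite (IHa x _ env') ?(IHb x _ env').
- case/andP=> ha hb e; rewrite (IHa x _ env') //; apply: (IHb x.+1) => //.
  by case=> //= y; rewrite eqSS; apply: e.
- by case/and3P=> ha hb hc e; rewrite (IHa x _ env') ?(IHb x _ env') ?(IHc x _ env').
- case/and3P=> hl ha hb e; rewrite (IHl x _ env') // (IHa x _ env') //.
  move: (items _) (sem _ a _) => L; elim: L => //= it L IH acc.
  rewrite IH; congr (foldl _ _ _); apply: (IHb x.+2) => //.
  by case=> [|[|y]] //=; rewrite !eqSS; apply: e.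
- by move=> ha e; rewrite (IHa x _ env').
Qed.

(** A term that does not read the accumulator keeps its value when [Nil] is put there, so its weight
    is bounded by item and environment alone. This supplies the increments that [additive_on] asks
    for. *)
Lemma wt_notfree f : notfree 1 f -> ptime_on anyenv f ->
  exists2 q, polybound q & forall O env acc it,
    (wt (sem O f (it :: acc :: env)) <= q (wt it + wenv env))%N.
Proof.
move=> nf [p pp hp]; exists (fun n => p (n + 1))%N; first by polyb.
move=> O env acc it; rewrite (@sem_notfree O f 1 _ (it :: Nil :: env)) //; last by case=> [|[]].
have -> : (wt it + wenv env + 1 = wenv (it :: Nil :: env))%N by rewrite !wenv_cons /=; lia.
have := hp O (it :: Nil :: env) I; lia.
Qed.

Lemma foldl_sim (A B C D : Type) (f : A -> B -> A) (g : C -> D -> C) (h : C -> A) (e : D -> B) :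
  (forall c d, f (h c) (e d) = h (g c d)) ->
  forall l c, foldl f (h c) (map e l) = h (foldl g c l).
Proof. by move=> H; elim=> //= d l IH c; rewrite H IH. Qed.

Definition t_rev (l : tm) : tm := TFold l (TConst Nil) (TPair (TVar 0) (TVar 1)).

Definition t_map (l f : tm) : tm := t_rev (TFold l (TConst Nil) (TPair f (TVar 1))).

Lemma foldl_cons (F : data -> data) (f : data -> data -> data) l acc :
  (forall it a, List.In it l -> f a it = Pair (F it) a) ->
  foldl f (enc_list acc) l = enc_list (rev (map F l) ++ acc).
Proof.
elim: l acc => //= x l IH acc h; rewrite h; last by left.
by rewrite (IH (F x :: acc)) ?rev_cons ?cat_rcons // => it a hit; apply: h; right.
Qed.

Lemma sem_rev O l env : sem O (t_rev l) env = enc_list (rev (items (sem O l env))).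
Proof. by rewrite /= (foldl_cons (F := id) [::]) // cats0 map_id. Qed.

Lemma sem_map O l f env (F : data -> data) :
  (forall it acc, List.In it (items (sem O l env)) -> sem O f (it :: acc :: env) = F it) ->
  sem O (t_map l f) env = enc_list (map F (items (sem O l env))).
Proof.
move=> h; rewrite sem_rev /= (foldl_cons (F := F) [::]) => [|it a hit]; last by rewrite h.
by rewrite items_enc cats0 revK.
Qed.

Lemma ptime_rev P l : ptime_on P l -> ptime_on P (t_rev l).
Proof.
move=> pl; apply: ptime_fold => //; first exact: ptime_const; last exact: ptime_simple.
exists (fun n => n + 1)%N; first by polyb.
move=> O env acc it _ /=; lia.
Qed.

Lemma ptime_map P l f : ptime_on P l -> notfree 1 f -> ptime_on anyenv f ->
  ptime_on P (t_map l f).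
Proof.
move=> pl nf pf; apply: ptime_rev; apply: ptime_fold => //; first exact: ptime_const.
- have [q pq hq] := wt_notfree nf pf; exists (fun n => q n + 1)%N; first by polyb.
  move=> O env acc it _ /=; have := hq O env acc it; lia.
- apply: ptime_pair => //; exact: ptime_var.
Qed.

(* Scalar product of the list [S] with the values [g] of the items of [l]; the
   accumulator is the rest of [S] and the partial sum. *)
Definition t_dot (l S g : tm) : tm :=
  TSnd (TFold l (TPair S (TConst (Num 0)))
    (TPair (TSnd (TFst (TVar 1)))
       (TOp Add (TSnd (TVar 1)) (TOp Mul g (TFst (TFst (TVar 1))))))).

Lemma sem_dot O l S g env n (a : 'I_n -> data) (x y : 'I_n -> rat) :
  sem O l env = enc_fun a -> sem O S env = enc_fun (fun i => Num (y i)) ->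
  (forall i acc, sem O g (a i :: acc :: env) = Num (x i)) ->
  sem O (t_dot l S g) env = Num (\sum_i x i * y i).
Proof.
move=> hl hS hg; rewrite /t_dot /= hl hS /enc_fun items_enc -[in RHS]big_enum /=.
have key : forall L r, foldl (fun acc it => Pair (dsnd (dfst acc))
    (dop Add (dsnd acc) (dop Mul (sem O g (it :: acc :: env)) (dfst (dfst acc)))))
     (Pair (enc_list [seq Num (y i) | i <- L]) (Num r)) [seq a i | i <- L] =
   Pair Nil (Num (r + \sum_(i <- L) x i * y i)).
  elim=> [|i L IH] r /=; first by rewrite big_nil addr0.
  by rewrite hg big_cons addrA -IH.
by rewrite key /= add0r.
Qed.

Lemma ptime_dot P l S g : ptime_on P l -> ptime_on P S -> notfree 1 g -> ptime_on anyenv g ->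
  ptime_on P (t_dot l S g).
Proof.
move=> pl pS ng pg; apply: ptime_snd.
apply: ptime_fold => //; first by apply: ptime_pair => //; apply: ptime_const.
- have [q pq hq] := wt_notfree ng pg; exists (fun n => q n + 7)%N; first by polyb.
  move=> O env acc it _ /=; have := hq O env acc it.
  move: (sem O g _) => v hv.
  have := wt_dop Add (dsnd acc) (dop Mul v (dfst (dfst acc))).
  have := wt_dop Mul v (dfst (dfst acc)).
  case: acc hv => [|u|[|u|s S'] sum] /=; lia.
- apply: ptime_pair; first exact: ptime_simple.
  apply: ptime_op; first exact: ptime_simple.
  by apply: ptime_op => //; exact: ptime_simple.
Qed.

(** * Programs for the joint replenishment problem *)

Definition enc_repl s (Q : replenishment s) : data :=
  enc_list [seq Pair (enc_set y.1) (Num y.2) | y <- Q].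

Definition enc_jrp_job s (I : jrp_data s) (j : 'I_(njobs I)) : data :=
  enc_list (rcons (enc_job j) (enc_set (required j))).

(** [None] becomes the only false value, so a test tells it apart even from date 0. *)
Definition enc_option (o : option rat) : data := if o is Some u then Num u else Nil.

Definition t_nth (n : nat) (t : tm) : tm := TFst (iter n TSnd t).

Lemma sem_nth O n t env l : sem O t env = enc_list l ->
  dfst (sem O (iter n TSnd t) env) = nth Nil l n.
Proof.
move=> h.
have -> : sem O (iter n TSnd t) env = enc_list (drop n l).
  elim: n => [|n IH] /=; first by rewrite drop0.
  rewrite IH -addn1 addnC -drop_drop; by case: (drop n l) => //= ? ?; rewrite drop0.
case: (ltnP n (size l)) => hn; first by rewrite (drop_nth Nil).
by rewrite drop_oversize // nth_default.
Qed.

Lemma simple_nth n t : simple (iter n TSnd t) = simple t.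
Proof. by elim: n => //= n ->. Qed.

Lemma notfree_nth x n t : notfree x (iter n TSnd t) = notfree x t.
Proof. by elim: n => //= n ->. Qed.

Lemma nth_enc_set s (A : {set 'I_s}) (i : 'I_s) :
  nth Nil [seq Num (k \in A)%:R | k <- enum 'I_s] i = Num (i \in A)%:R.
Proof. by rewrite (nth_map i) ?size_enum_ord // nth_ord_enum. Qed.

Lemma le1_bool (b : bool) : (1 <= b%:R :> rat) = b.
Proof. by case: b. Qed.

Lemma truth_of_bool b : truth (of_bool b) = b.
Proof. by case: b. Qed.

Definition t_job_date (j : nat) : tm := TFst (TSnd (TVar j)).
Definition t_job_weight (j : nat) : tm := TFst (TSnd (TSnd (TVar j))).
Definition t_job_set (j : nat) : tm := TFst (TSnd (TSnd (TSnd (TVar j)))).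

(* In the programs below [j] and [q] are the variables holding the job and the
   replenishment structure. *)
Definition t_first (n j q : nat) : tm :=
  TFold (TVar q) (TConst Nil)
    (TIf (TVar 1) (TVar 1)
      (TIf (TOp Le (t_job_date j.+2) (TSnd (TVar 0)))
        (TIf (TOp Le (TConst (Num 1)) (t_nth n (TFst (TVar 0))))
          (TSnd (TVar 0)) (TConst Nil))
        (TConst Nil))).

(** The recursion runs when the program is built: [s] is fixed, so the program contains one block
    per resource. *)
Fixpoint t_date (n j q : nat) : tm :=
  if n is n'.+1 then
    TLet (t_date n' j q)
      (TIf (TVar 0)
        (TIf (TOp Le (TConst (Num 1)) (t_nth n' (t_job_set j.+1)))
          (TLet (t_first n' j.+1 q.+1)
            (TIf (TVar 0) (TIf (TOp Le (TVar 1) (TVar 0)) (TVar 0) (TVar 1)) (TConst Nil)))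
          (TVar 0))
        (TConst Nil))
  else t_job_date j.

Lemma sem_first O s (I : jrp_data s) (k : 'I_(njobs I)) (Q : replenishment s) (i : 'I_s) j q env :
  nth Nil env j = enc_jrp_job k -> nth Nil env q = enc_repl Q ->
  sem O (t_first i j q) env = enc_option (first_time Q (rdate k) i).
Proof.
move=> hj hq; rewrite /t_first /= hq hj /enc_repl items_enc /first_time /=.
apply: (@foldl_sim _ _ _ _ _ (first_step (rdate k) i) enc_option _ _ Q None) => -[u|] x //=.
rewrite (@sem_nth O i (TFst (TVar 0)) _ [seq Num (k \in x.1)%:R | k <- enum 'I_s]) //.
rewrite nth_enc_set /= le1_bool !truth_of_bool.
by case: (_ <= _); case: (_ \in _).
Qed.

Lemma sem_date O s (I : jrp_data s) (k : 'I_(njobs I)) (Q : replenishment s) n j q env :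
  nth Nil env j = enc_jrp_job k -> nth Nil env q = enc_repl Q -> (n <= s)%N ->
  sem O (t_date n j q) env = enc_option (induced_upto Q (rdate k) (required k) n).
Proof.
move=> hj hq; elim: n => [|n IH] hn; first by rewrite /= hj.
rewrite /= IH; last exact: ltnW.
rewrite /induced_step; case: (induced_upto _ _ _ _) => //= u.
pose i := Ordinal hn.
have -> : insub n = Some i :> option 'I_s by rewrite insubT.
rewrite (@sem_nth O i _ _ [seq Num (i \in required k)%:R | i <- enum 'I_s]); last by rewrite /= hj.
rewrite nth_enc_set /dop /= le1_bool truth_of_bool; case: ifP => // _.
have hf := @sem_first O s I k Q i j.+1 q.+1 (Num u :: env) hj hq.
move: hf; rewrite /t_first /= => ->; case: (first_time _ _ _) => //= v.
by rewrite /dop /= truth_of_bool; case: (_ <= _).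
Qed.

Lemma ptime_first P n j q : ptime_on P (t_first n j q).
Proof.
apply: ptime_fold; [exact: ptime_var|exact: ptime_const| |].
- exists id; first by polyb.
  move=> O env acc it _ /=; case: ifP => _; first lia.
  case: ifP => _ /=; last by have := wt_gt0 acc; have := wt_gt0 it; lia.
  by case: ifP => _ /=; have := wt_dsnd it; have := wt_gt0 acc; have := wt_gt0 it; lia.
- by apply: ptime_simple; rewrite /= simple_nth.
Qed.

Lemma ptime_date P n j q : ptime_on P (t_date n j q).
Proof.
elim: n P j q => [|n IH] P j q; first exact: ptime_simple.
apply: (@ptime_let _ anyenv) => //.
apply: (@ptime_if _ anyenv anyenv) => //; first exact: ptime_var; last exact: ptime_const.
apply: (@ptime_if _ anyenv anyenv) => //; last exact: ptime_var.
  by apply: ptime_simple; rewrite /= simple_nth.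
apply: (@ptime_let _ anyenv) => //; [exact: ptime_first|exact: ptime_simple].
Qed.

Lemma notfree_date x n j q : x != j -> x != q -> notfree x (t_date n j q).
Proof.
move=> xj xq; have jx : j != x by rewrite eq_sym. have qx : q != x by rewrite eq_sym.
by elim: n => //= n ->; rewrite /t_first /= !notfree_nth /= !eqSS jx qx.
Qed.

Section Programs.

Variables (s tau : nat).

Definition t_feasible (l : tm) (q : nat) : tm :=
  TFold l (TConst (Num 1))
    (TIf (TVar 1) (TIf (t_date s 0 q.+2) (TConst (Num 1)) (TConst Nil)) (TConst Nil)).

Lemma sem_feasible O (I : jrp_data s) (Q : replenishment s) l q env :
  sem O l env = enc_fun (@enc_jrp_job s I) -> nth Nil env q = enc_repl Q ->
  truth (sem O (t_feasible l q) env) = [forall j, isSome (@induced_date s I Q j)].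
Proof.
move=> hl hq; rewrite /t_feasible /= hl /enc_fun items_enc.
have -> : [forall j, isSome (@induced_date s I Q j)] =
  all (fun j => isSome (@induced_date s I Q j)) (enum 'I_(njobs I)).
  apply/forallP/allP => h j => [_|]; first exact: h.
  by apply: h; rewrite mem_enum.
have key : forall L b, truth (foldl (fun acc it =>
    if truth acc then if truth (sem O (t_date s 0 q.+2) [:: it, acc & env]) then Num 1 else Nil
    else Nil) (of_bool b) [seq enc_jrp_job j | j <- L]) =
    b && all (fun j => isSome (@induced_date s I Q j)) L.
  elim=> [|j L IH] b /=; first by rewrite truth_of_bool andbT.
  rewrite truth_of_bool (@sem_date O s I j Q) // -/(induced_date Q j) andbA -IH.
  by congr (truth (foldl _ _ _)); case: b; case: (induced_date Q j).
exact: key true.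
Qed.

Lemma ptime_feasible P l q : ptime_on P l -> ptime_on P (t_feasible l q).
Proof.
move=> pl; apply: ptime_fold => //; first exact: ptime_const.
- exists (fun=> 3)%N; first by polyb.
  by move=> O env acc it _ /=; do 2?case: ifP => _ //=; apply: leq_trans (leq_addl _ _).
- do 2!(apply: (@ptime_if _ anyenv anyenv) => //; try exact: ptime_simple).
  exact: ptime_date.
Qed.

Definition t_inst (l : tm) (q : nat) : tm :=
  t_map l (TPair (TFst (TVar 0)) (TPair (t_date s 0 q.+2)
            (TPair (t_job_weight 0) (TConst Nil)))).

(** The default date matters only for structures that fail the feasibility test, and these never
    reach the oracle. *)
Definition induced_jobs (I : jrp_data s) (Q : replenishment s) : jobs :=
  @Jobs (njobs I) (@ptime I) (fun j => odflt 0 (induced_date Q j)) (@weight I).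

Lemma sem_inst O (I : jrp_data s) (Q : replenishment s) l q env :
  sem O l env = enc_fun (@enc_jrp_job s I) -> nth Nil env q = enc_repl Q ->
  [forall j, isSome (@induced_date s I Q j)] ->
  sem O (t_inst l q) env =
  enc_fun (fun j : 'I_(njobs (induced_jobs I Q)) => enc_list (enc_job j)).
Proof.
move=> hl hq /forallP hf.
pose F d := Pair (dfst d) (Pair (sem O (t_date s 0 q.+2) (d :: Nil :: env))
             (Pair (dfst (dsnd (dsnd d))) Nil)).
rewrite (@sem_map O l _ env F); last first.
  move=> it acc _ /=; rewrite /F; congr (Pair _ (Pair _ _)).
  by apply: (@sem_notfree _ _ 1); [rewrite notfree_date|case=> [|[]]].
rewrite hl /enc_fun items_enc -map_comp; congr enc_list; apply: eq_map => j /=.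
rewrite /F (@sem_date O s I j Q) //= -/(induced_date Q j).
by have := hf j; case: (induced_date Q j).
Qed.

Lemma ptime_inst P l q : ptime_on P l -> ptime_on P (t_inst l q).
Proof.
move=> pl; apply: ptime_map => //; first by rewrite /= notfree_date.
apply: ptime_pair; first exact: ptime_simple.
apply: ptime_pair; [exact: ptime_date|exact: ptime_simple].
Qed.

(* [i] is the variable holding the encoded instance. *)
Definition t_repl_cost (q i : nat) : tm :=
  TFold (TVar q) (TConst (Num 0))
    (TOp Add (TVar 1) (TOp Add (TFst (TSnd (TVar i.+2)))
       (t_dot (TSnd (TSnd (TVar i.+2))) (TFst (TVar 0)) (TVar 0)))).

Lemma sem_repl_cost O (I : jrp_data s) (Q : replenishment s) q i env :
  nth Nil env q = enc_repl Q -> nth Nil env i = @enc_instance (jrp_problem s tau) I ->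
  sem O (t_repl_cost q i) env = Num (replenishment_cost I Q).
Proof.
move=> hq hi; rewrite /t_repl_cost /replenishment_cost.
set B := TOp Add _ _.
have hB : forall acc (x : {set 'I_s} * rat),
   sem O B [:: Pair (enc_set x.1) (Num x.2), Num acc & env] =
   Num (acc + (cost0 I + \sum_(k in x.1) res_cost I k)).
  move=> acc x; rewrite /B.
  have := @sem_dot O (TSnd (TSnd (TVar i.+2))) (TFst (TVar 0)) (TVar 0)
    [:: Pair (enc_set x.1) (Num x.2), Num acc & env] s (fun k => Num (res_cost I k))
    (res_cost I) (fun k => (k \in x.1)%:R).
  rewrite /= hi /= => -> //.
  rewrite /dop /=; congr (Num (_ + (_ + _))).
  rewrite [RHS]big_mkcond; apply: eq_bigr => k _.
  by case: (k \in x.1); rewrite ?mulr1 ?mulr0.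
rewrite -[in RHS](add0r (\sum_(_ <- _) _)).
move: B hB => B hB; rewrite /= hq /enc_repl items_enc.
have key : forall r, foldl (fun acc it => sem O B [:: it, acc & env]) (Num r)
    [seq Pair (enc_set y.1) (Num y.2) | y <- Q] =
    Num (r + \sum_(x <- Q) (cost0 I + \sum_(k in x.1) res_cost I k)).
  elim: Q {hq} => [|x Q IH] r /=; first by rewrite big_nil addr0.
  by rewrite hB IH big_cons !addrA.
exact: key.
Qed.

Lemma ptime_repl_cost P q i : ptime_on P (t_repl_cost q i).
Proof.
pose X := TOp Add (TFst (TSnd (TVar i.+2)))
       (t_dot (TSnd (TSnd (TVar i.+2))) (TFst (TVar 0)) (TVar 0)).
have pX : ptime_on anyenv X.
  by apply: ptime_op; [exact: ptime_simple|apply: ptime_dot => //; exact: ptime_simple].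
apply: ptime_fold; [exact: ptime_var|exact: ptime_const| |].
- have [q' pq hq] := wt_notfree (isT : notfree 1 X) pX.
  exists (fun n => q' n + 1)%N; first by polyb.
  move=> O env acc it _; have h := hq O env acc it.
  apply: leq_trans (wt_dop Add acc (sem O X [:: it, acc & env])) _; lia.
- by apply: ptime_op => //; exact: ptime_simple.
Qed.

End Programs.

(** * Enumerating the candidate replenishment structures *)

Definition min_step (th : rat) (a : option rat) (r : rat) : option rat :=
  if r <= th then a else if a is Some u then Some (if u <= r then u else r) else Some r.

Definition min_above (th : rat) (rs : seq rat) : option rat := foldl (min_step th) None rs.

Lemma min_aboveP th rs :
  if min_above th rs is Some u then
    [/\ u \in rs, th < u & forall r, r \in rs -> th < r -> u <= r]
  else forall r, r \in rs -> r <= th.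
Proof.
rewrite /min_above; elim/last_ind: rs => // rs r IH; rewrite foldl_rcons.
rewrite {1}/min_step; case: (leP r th) => hr.
  case: (foldl _ _ _) IH => [u [h1 h2 h3]|h].
    split=> //; first by rewrite mem_rcons inE h1 orbT.
    move=> x; rewrite mem_rcons inE => /orP[/eqP->|]; last exact: h3.
    by rewrite ltNge hr.
  by move=> x; rewrite mem_rcons inE => /orP[/eqP->|/h].
case: (foldl _ _ _) IH => [u [h1 h2 h3]|h].
  case: (leP u r) => ur; split=> //.
  - by rewrite mem_rcons inE h1 orbT.
  - by move=> x; rewrite mem_rcons inE => /orP[/eqP->|]; last exact: h3.
  - by rewrite mem_rcons inE eqxx.
  - move=> x; rewrite mem_rcons inE => /orP[/eqP->//|hx thx].
    by apply: le_trans (ltW ur) _; apply: h3.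
split=> //; first by rewrite mem_rcons inE eqxx.
move=> x; rewrite mem_rcons inE => /orP[/eqP->//|/h].
by rewrite leNgt => /negP hx /hx.
Qed.

(** [T] is decreasing, so its head is the largest date found so far. Release dates are nonnegative,
    hence -1 lies below all of them and starts the search. *)
Definition next_time (rs T : seq rat) : seq rat :=
  if min_above (head (-1) T) rs is Some u then u :: T else T.

Lemma iter_next_timeP (rs : seq rat) n (T := iter n (next_time rs) [::]) :
  (forall r, r \in rs -> 0 <= r) ->
  [/\ sorted >%R T, {subset T <= rs},
      forall r, r \in rs -> r \in T \/ head (-1) T < r
    & size T = n \/ {subset rs <= T}].
Proof.
move=> pos; rewrite {}/T; elim: n => [|n] /=.
  split=> //; last by left.
  by move=> r /pos r0; right; apply: lt_le_trans r0; lra.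
set T := iter _ _ _ => -[sT subT hT szT].
rewrite /next_time; have := min_aboveP (head (-1) T) rs.
case: (min_above _ _) => [u [urs uT umin]|none].
- split.
  + by case: (T) sT uT => //= t T' -> ->.
  + by move=> x; rewrite inE => /orP[/eqP->|/subT].
  + move=> r rrs; have [rT|rT] := hT r rrs; first by left; rewrite inE rT orbT.
    have := umin r rrs rT; rewrite le_eqVlt => /orP[/eqP<-|]; last by right.
    by left; rewrite inE eqxx.
  + case: szT => [<-|rsT]; first by left.
    have := rsT u urs; move: uT sT; case: (T) => //= t T' tu pT.
    rewrite inE => /orP[/eqP e|uT']; first by rewrite e ltxx in tu.
    move/(order_path_min (rev_trans lt_trans))/allP/(_ u uT'): pT => /= ut.
    by have := lt_trans tu ut; rewrite ltxx.
- split=> //; right=> r rrs; have [//|] := hT r rrs.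
  by rewrite ltNge none.
Qed.

Section Candidates.

Variables (s tau : nat).

Local Notation repl := (seq ({set 'I_s} * rat)).

(** Every old structure is kept, for no replenishment at [t], and copied once per subset. New
    entries go to the front, so processing dates in decreasing order yields structures sorted by
    increasing time. *)
Definition add_time (acc : seq repl) (t : rat) : seq repl :=
  foldl (fun acc' (A : {set 'I_s}) => foldl (fun a Q => ((A, t) :: Q) :: a) acc' acc) acc
    (enum {set 'I_s}).

Definition candidates (T : seq rat) : seq repl := foldl add_time [:: [::]] T.

Lemma mem_add_time acc t (Q : repl) :
  (Q \in add_time acc t) =
  (Q \in acc) || (if Q is (A, t') :: Q' then (t' == t) && (Q' \in acc) else false).
Proof.
have inner : forall L A acc' (R : repl),
  (R \in foldl (fun a Q => ((A, t) :: Q) :: a) acc' L) =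
  (R \in acc') || (if R is (A', t') :: R' then [&& A' == A, t' == t & R' \in L] else false).
  elim=> [|x L IH] A acc' R /=.
    by rewrite -[LHS]orbF; congr (_ || _); case: R => //= -[A' t'] R'; rewrite in_nil !andbF.
  rewrite IH inE; case: (R \in acc'); rewrite ?orbT //= orbF.
  case: R => [|[A' t'] R'] //=; rewrite eqseq_cons xpair_eqE inE /=.
  by case: (A' == A); case: (t' == t).
have outer : forall Es acc',
  (Q \in foldl (fun acc' (A : {set 'I_s}) => foldl (fun a Q => ((A, t) :: Q) :: a) acc' acc)
     acc' Es) =
  (Q \in acc') ||
  (if Q is (A, t') :: Q' then [&& A \in Es, t' == t & Q' \in acc] else false).
  elim=> [|A Es IH] acc' /=; first by case: Q => [|[B u] Q']; rewrite ?in_nil /= orbF.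
  rewrite IH inner -orbA; congr (_ || _); case: Q {IH} => [|[B u] Q'] //=.
  by rewrite inE; case: (B == A); case: (B \in Es); rewrite //= ?orbF ?orbb.
rewrite /add_time outer; congr (_ || _); case: Q {outer} => [|[B u] Q'] //.
by rewrite mem_enum.
Qed.

Lemma candidates_subseq T (Q : repl) : Q \in candidates T ->
  subseq [seq y.2 | y <- Q] (rev T).
Proof.
rewrite /candidates; elim/last_ind: T Q => [|T t IH] Q.
  by rewrite /= inE => /eqP->.
rewrite foldl_rcons rev_rcons mem_add_time => /orP[/IH h|].
  exact: subseq_trans h (subseq_cons _ _).
by case: Q => [|[A u] Q] //= /andP[/eqP-> /IH h]; rewrite eqxx.
Qed.

Lemma select_candidates T A : (@select s (rev T) A : repl) \in candidates T.
Proof.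
rewrite /candidates; elim/last_ind: T => [|T t IH]; first by rewrite inE.
rewrite foldl_rcons rev_rcons mem_add_time /=.
by case: (A t) => [B|] /=; rewrite ?IH ?eqxx ?orbT.
Qed.

(** The environment holds the threshold, the item of the outer loop, the dates found and the
    instance as variables 0 to 3. *)
Definition t_min : tm :=
  TFold (TFst (TVar 3)) (TConst Nil)
    (TIf (TOp Le (t_job_date 0) (TVar 2)) (TVar 1)
      (TIf (TVar 1) (TIf (TOp Le (TVar 1) (t_job_date 0)) (TVar 1) (t_job_date 0))
        (t_job_date 0))).

Definition t_next : tm :=
  TLet (TIf (TIsPair (TVar 1)) (TFst (TVar 1)) (TConst (Num (-1))))
    (TLet t_min (TIf (TVar 0) (TPair (TVar 0) (TVar 3)) (TVar 3))).

(** The constant list of length [tau] is a loop counter. *)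
Definition t_times : tm := TFold (TConst (enc_list (nseq tau Nil))) (TConst Nil) t_next.

Definition rdates (J : jobs) : seq rat := [seq @rdate J j | j <- enum 'I_(njobs J)].

Definition times (J : jobs) : seq rat := iter tau (next_time (rdates J)) [::].

Definition enc_times (T : seq rat) : data := enc_list [seq Num t | t <- T].

Local Notation inst I := (@enc_instance (jrp_problem s tau) I).

Lemma sem_min O (I : jrp_data s) th it acc :
  sem O t_min [:: Num th; it; acc; inst I] = enc_option (min_above th (rdates I)).
Proof.
rewrite /t_min /= /enc_fun items_enc /min_above /rdates.
rewrite (@foldl_sim _ _ _ _ _ (fun a j => min_step th a (@rdate I j)) enc_option _ _ _ None).
  congr enc_option; elim: (enum _) None => //= j L IH o; exact: IH.
move=> o j /=; rewrite /dop /min_step /= truth_of_bool; case: ifP => // _.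
by case: o => //= u; rewrite truth_of_bool; case: ifP.
Qed.

Lemma sem_next O (I : jrp_data s) it T :
  sem O t_next [:: it; enc_times T; inst I] = enc_times (next_time (rdates I) T).
Proof.
have h := @sem_min O I (head (-1) T) it (enc_times T).
rewrite /t_next /next_time.
transitivity (sem O (TLet t_min (TIf (TVar 0) (TPair (TVar 0) (TVar 3)) (TVar 3)))
  [:: Num (head (-1) T); it; enc_times T; inst I]).
  by case: T {h}.
move: h; set M := t_min => h.
rewrite -[LHS]/(if truth (sem O M [:: Num (head (-1) T); it; enc_times T; inst I]) then
   Pair (sem O M [:: Num (head (-1) T); it; enc_times T; inst I]) (enc_times T)
   else enc_times T).
by rewrite h; case: (min_above _ _).
Qed.

Lemma sem_times O (I : jrp_data s) : sem O t_times [:: inst I] = enc_times (times I).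
Proof.
rewrite /times /t_times.
rewrite -[LHS]/(foldl (fun acc it => sem O t_next [:: it; acc; inst I]) (enc_times [::])
  (items (enc_list (nseq tau Nil)))) items_enc.
have : forall it T, _ := @sem_next O I; move: (sem O t_next) => F hF.
have key : forall L T, foldl (fun acc it => F [:: it; acc; inst I]) (enc_times T) L =
    enc_times (iter (size L) (next_time (rdates I)) T).
  by elim=> // x L IH T; rewrite [LHS]/= hF IH -iterSr.
by rewrite key size_nseq.
Qed.

Lemma ptime_times P : ptime_on P t_times.
Proof.
have pmin P' : ptime_on P' t_min.
  apply: ptime_fold; [exact: ptime_simple|exact: ptime_const| |exact: ptime_simple].
  exists id; first by polyb.
  move=> O env acc it _ /=.
  have hr := leq_trans (wt_dfst (dsnd it)) (wt_dsnd it).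
  by do 3?[case: ifP => _]; lia.
apply: ptime_fold; [exact: ptime_const|exact: ptime_const| |].
- exists (fun n => (n + 1) * (n + 1) + 2)%N; first by polyb.
  move=> O env acc it _ /=.
  set m := foldl _ _ _.
  suff hm : (wt m <= 1 + (wenv env + 1) * (wenv env + 1))%N.
    case: ifP => _ /=; nia.
  have hl : (wt (dfst (nth Nil env 0)) <= wenv env + 1)%N.
    by rewrite addn1; apply: leq_trans (wt_dfst _) (wt_nth _ _).
  apply: leq_trans (wt_foldl (c := wenv env + 1) _ _) _; last first.
    by rewrite leq_add2l leq_mul2r (leq_trans (size_items _) hl) orbT.
  move=> a x hx; have hwx := leq_trans (wt_items hx) hl.
  have hr := leq_trans (wt_dfst (dsnd x)) (wt_dsnd x).
  by do 3?[case: ifP => _]; lia.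
- apply: (@ptime_let _ anyenv) => //; first exact: ptime_simple.
  apply: (@ptime_let _ anyenv) => //; exact: ptime_simple.
Qed.

End Candidates.

Lemma size_iter_next_time rs n : (size (iter n (next_time rs) [::]) <= n)%N.
Proof. by elim: n => //= n IH; rewrite {1}/next_time; case: (min_above _ _) => /= *; lia. Qed.

Lemma timesP tau (J : jobs) : valid_jobs tau J ->
  [/\ sorted >%R (times tau J), forall j, @rdate J j \in times tau J
    & {subset times tau J <= rdates J}].
Proof.
move=> [pos sz].
have pos' r : r \in rdates J -> 0 <= r by move=> /mapP[j _ ->]; case: (pos j).
have [sT subT _ hT] := @iter_next_timeP (rdates J) tau pos'.
have uT : uniq (times tau J).
  by apply: (sorted_uniq (rev_trans lt_trans)) sT => x; apply: ltxx.
split=> // j; have jin : rdate j \in rdates J by apply: map_f; rewrite mem_enum.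
case: hT => [szT|]; last exact.
(* A missing date together with the [tau] dates found would give [tau + 1] distinct release
   dates. *)
apply/negPn/negP => jT.
have : (size (rdate j :: times tau J) <= size (undup (rdates J)))%N.
  apply: uniq_leq_size; first by rewrite /= jT.
  by move=> x; rewrite mem_undup inE => /orP[/eqP->//|/subT].
rewrite /= {1}/times szT => h; have := leq_trans h sz; by rewrite ltnn.
Qed.

Section Enumeration.

Variables (s tau : nat).

Local Notation inst I := (@enc_instance (jrp_problem s tau) I).

Definition enc_cands (l : seq (replenishment s)) : data :=
  enc_list [seq enc_repl Q | Q <- l].

(* Programs on a pair of the remaining dates and the candidates so far. *)
Definition t_add : tm :=
  TFold (TConst (enc_list [seq enc_set A | A <- enum {set 'I_s}])) (TSnd (TVar 0))
    (TFold (TSnd (TVar 2)) (TVar 1)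
      (TPair (TPair (TPair (TVar 2) (TFst (TFst (TVar 4)))) (TVar 0)) (TVar 1))).

Lemma sem_add O t T acc env :
  sem O t_add (Pair (enc_times (t :: T)) (enc_cands acc) :: env) = enc_cands (add_time acc t).
Proof.
rewrite /t_add /= !items_enc.
apply: (@foldl_sim _ _ _ _ _
  (fun acc' (A : {set 'I_s}) => foldl (fun a Q => ((A, t) :: Q) :: a) acc' acc) enc_cands
  (@enc_set s) _ (enum {set 'I_s}) acc) => acc' A.
exact: (@foldl_sim _ _ _ _ _ (fun a Q => ((A, t) :: Q) :: a) enc_cands).
Qed.

Lemma ptime_add P : ptime_on P t_add.
Proof.
apply: ptime_fold; [exact: ptime_const|exact: ptime_simple| |].
(* The structures to be copied are read from the environment and not from the accumulator, so growth
   is additive: at most [n + 1] copies, each adding a subset, the date and an old structure. *)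
- exists (fun n => (n + 1) * (3 * n + 6))%N; first by polyb.
  move=> O env acc it _ /=.
  set n := (wt it + wenv env)%N.
  have h0 : (wt (nth Nil env 0) <= n + 1)%N by have := wt_nth env 0; rewrite /n; lia.
  have h1 := leq_trans (wt_dsnd _) h0.
  have h2 := leq_trans (wt_dfst _) (leq_trans (wt_dfst _) h0).
  have hn : (wt it <= n)%N by rewrite /n; lia.
  apply: leq_trans (wt_foldl (c := 3 * n + 6) _ _) _; last first.
    by rewrite leq_add2l leq_mul2r (leq_trans (size_items _) h1) orbT.
  move=> a Q hQ /=; have := leq_trans (wt_items hQ) h1; lia.
- apply: ptime_fold; [exact: ptime_simple|exact: ptime_var| |exact: ptime_simple].
  exists (fun n => 3 * n + 6)%N; first by polyb.
  move=> O env acc it _ /=.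
  have := wt_nth env 0; have := wt_nth env 2; have := wt_dfst (dfst (nth Nil env 2)).
  have := wt_dfst (nth Nil env 2); lia.
Qed.

(** A loop over the dates would multiply its accumulator at each pass and violate [additive_on].
    Unrolling it [tau] times gives a composition of a fixed number of polynomially bounded steps. *)
Fixpoint t_cands (n : nat) : tm :=
  if n is n'.+1 then
    TLet (t_cands n')
      (TIf (TIsPair (TFst (TVar 0))) (TPair (TSnd (TFst (TVar 0))) t_add) (TVar 0))
  else TPair (t_times tau) (TConst (Pair Nil Nil)).

Lemma sem_cands_upto O (I : jrp_data s) n :
  sem O (t_cands n) [:: inst I] =
  Pair (enc_times (drop n (times tau I)))
       (enc_cands (foldl (@add_time s) [:: [::]] (take n (times tau I)))).
Proof.
elim: n => [|n IH].
  rewrite take0 drop0 -(sem_times tau O I); by [].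
rewrite /t_cands -/t_cands; set C := t_cands n in IH *.
move: (fun t T acc => @sem_add O t T acc [:: inst I]); set A := t_add => hA.
rewrite -[LHS]/((fun v => if truth (dispair (dfst v)) then
  Pair (dsnd (dfst v)) (sem O A [:: v; inst I]) else v) (sem O C [:: inst I])) IH.
case: (ltnP n (size (times tau I))) => hn; last first.
  by rewrite !drop_oversize ?take_oversize //; apply: leqW.
by rewrite (drop_nth 0 hn) (take_nth 0 hn) foldl_rcons -(hA _ (drop n.+1 (times tau I))).
Qed.

Lemma sem_cands O (I : jrp_data s) :
  sem O (TSnd (t_cands tau)) [:: inst I] = enc_cands (candidates s (times tau I)).
Proof.
rewrite -[LHS]/(dsnd (sem O (t_cands tau) [:: inst I])) sem_cands_upto take_oversize //.
exact: size_iter_next_time.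
Qed.

Lemma ptime_cands P n : ptime_on P (t_cands n).
Proof.
elim: n P => [|n IH] P; first by apply: ptime_pair; [exact: ptime_times|exact: ptime_const].
apply: (@ptime_let _ anyenv) => //.
apply: (@ptime_if _ anyenv anyenv) => //; [exact: ptime_simple| |exact: ptime_var].
by apply: ptime_pair; [exact: ptime_simple|exact: ptime_add].
Qed.

Lemma candidate_sorted (J : jobs) Q : valid_jobs tau J ->
  Q \in candidates s (times tau J) -> sorted <%R [seq y.2 | y <- Q].
Proof.
move=> /timesP[sT _ _] /candidates_subseq hQ.
by apply: (subseq_sorted lt_trans hQ); rewrite rev_sorted.
Qed.

(** Replenishing everything at every release date turns any schedule respecting the release dates
    into a feasible solution. This provides a feasible candidate in one reduction and the comparison
    solution in the other. *)
Lemma select_ready (I : jrp_data s) (S : schedule I) :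
  valid_jobs tau I -> (forall j, rdate j <= S j) ->
  forall j, ready (@select s (rev (times tau I)) (fun=> Some setT)) j (S j).
Proof.
move=> /timesP[_ rT _] rS j; apply/subsetP => i _; apply/in_bigcup_seq.
exists (setT, rdate j); split=> /=; last by rewrite inE.
- by apply: (@in_select s) => //; rewrite mem_rev.
- by rewrite lexx rS.
Qed.

(** An induced date is the release date of the job or a time of [Q], and a candidate uses only
    release dates; hence no new date appears and the bound [tau] survives. *)
Lemma induced_jobs_valid (I : jrp_data s) Q : valid_jrp tau I ->
  Q \in candidates s (times tau I) -> [forall j, isSome (@induced_date s I Q j)] ->
  valid_jobs tau (induced_jobs I Q).
Proof.
move=> [vJ _ _ _] hQ /forallP hf.
have [_ _ subT] := timesP vJ; have [pos sz] := vJ.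
have mem j : odflt 0 (@induced_date s I Q j) \in rdates I.
  have := hf j; case E : (induced_date Q j) => [u|] // _.
  have /= := induced_upto_mem E; rewrite inE => /orP[/eqP->|].
    by apply: map_f; rewrite mem_enum.
  move/(mem_subseq (candidates_subseq hQ)); rewrite mem_rev; exact: subT.
split=> [j|].
  have [p0 _ w0] := pos j; split=> //=.
  by have /mapP[k _ ->] := mem j; case: (pos k).
apply: leq_trans sz; apply: uniq_leq_size; first exact: undup_uniq.
by move=> x; rewrite !mem_undup => /mapP[j _ ->]; apply: mem.
Qed.

(* The candidate, the best value so far and the instance are variables 0, 1, 2.
   The constant [\sum_j w_j p_j] is dropped from the objective. *)
Definition t_eval : tm :=
  TIf (t_feasible s (TFst (TVar 2)) 0)
    (TLet (TAsk (t_inst s (TFst (TVar 2)) 0))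
      (TPair (TOp Add (t_dot (TFst (TVar 3)) (TVar 0) (t_job_weight 0)) (t_repl_cost 1 3))
        (TPair (TVar 0) (TVar 1))))
    (TConst Nil).

Lemma sem_eval_infeasible O (I : jrp_data s) Q acc :
  ~~ [forall j, isSome (@induced_date s I Q j)] ->
  sem O t_eval [:: enc_repl Q; acc; inst I] = Nil.
Proof.
move=> h; have := @sem_feasible s O I Q (TFst (TVar 2)) 0 [:: enc_repl Q; acc; inst I] erefl erefl.
rewrite (negPf h) /t_eval; move: (t_feasible _ _ _) => F hF.
by rewrite -[LHS]/(if truth (sem O F _) then _ else Nil) hF.
Qed.

Lemma sem_eval O (I : jrp_data s) Q acc :
  solves (classical_problem tau) O -> valid_jrp tau I ->
  Q \in candidates s (times tau I) -> [forall j, isSome (@induced_date s I Q j)] ->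
  exists2 S : schedule (induced_jobs I Q), sched_optimal S &
    sem O t_eval [:: enc_repl Q; acc; inst I] =
    Pair (Num (\sum_(j < njobs I) weight j * S j + replenishment_cost I Q))
      (Pair (enc_fun (fun j => Num (S j))) (enc_repl Q)).
Proof.
move=> hO vI hQ hf; have vJ := induced_jobs_valid vI hQ hf.
have [S optS eS] := hO (induced_jobs I Q) vJ.
exists S; first exact: optS.
set env := [:: enc_repl Q; acc; inst I].
have := @sem_feasible s O I Q (TFst (TVar 2)) 0 env erefl erefl.
have := @sem_inst s O I Q (TFst (TVar 2)) 0 env erefl erefl hf.
rewrite hf /t_eval; move: (t_feasible _ _ _) (t_inst _ _ _) => F G hG hF.
set d := enc_fun (fun j => Num (S j)).
have hd := @sem_dot O (TFst (TVar 3)) (TVar 0) (t_job_weight 0) (d :: env) (njobs I)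
  (@enc_jrp_job s I) (@weight I) S erefl erefl (fun i acc => erefl).
have hc := @sem_repl_cost s tau O I Q 1 3 (d :: env) erefl erefl.
move: (t_dot _ _ _) (t_repl_cost _ _) hd hc => D R hd hc.
rewrite -[LHS]/(if truth (sem O F env) then
  let v := O (sem O G env) in
  Pair (dop Add (sem O D (v :: env)) (sem O R (v :: env))) (Pair v (enc_repl Q)) else Nil).
by rewrite hF /= hG eS -/d hd hc.
Qed.

(** * Selecting the cheapest candidate *)

Definition better (acc v : data) : data :=
  if truth v then
    if truth acc then if truth (dop Le (dfst acc) (dfst v)) then acc else v else v
  else acc.

Definition t_best : tm :=
  TFold (TSnd (t_cands tau)) (TConst Nil)
    (TLet t_eval
      (TIf (TVar 0)
        (TIf (TVar 2) (TIf (TOp Le (TFst (TVar 2)) (TFst (TVar 0))) (TVar 2) (TVar 0)) (TVar 0))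
        (TVar 2))).

Definition is_value (v : data) := v = Nil \/ exists c d, v = Pair (Num c) d.

Lemma foldl_better vs acc : (forall v, List.In v (acc :: vs) -> is_value v) ->
  let r := foldl better acc vs in
  List.In r (acc :: vs) /\
  forall c d, List.In (Pair (Num c) d) (acc :: vs) ->
    exists c' d', r = Pair (Num c') d' /\ c' <= c.
Proof.
elim: vs acc => [|v vs IH] acc hv /=.
  by split; [left|move=> c d [->|//]; exists c, d].
have bcase : better acc v = acc \/ better acc v = v.
  by rewrite /better; do 3?[case: ifP => _]; auto.
have [|h1 h2] := IH (better acc v).
  move=> w [<-|hw]; last by apply: hv; right; right.
  by case: bcase => ->; apply: hv; [left|right; left].
split.
  by case: h1 => [<-|h1]; [case: bcase => ->; auto|auto].
have trans (c : rat) : forall c0 d0, better acc v = Pair (Num c0) d0 -> c0 <= c ->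
   exists c' d', foldl better (better acc v) vs = Pair (Num c') d' /\ c' <= c.
  move=> c0 d0 e le0; have [|c' [d' [e' le']]] := h2 c0 d0; first by left.
  by exists c', d'; split=> //; apply: le_trans le0.
move=> c d [e|[e|hin]]; last by apply: h2 (or_intror hin).
- have [ev|[c1 [d1 ev]]] := hv v (or_intror (or_introl erefl)).
    by apply: (trans c c d) => //; rewrite /better ev.
  case: (leP c c1) => cc.
    by apply: (trans c c d) => //; rewrite /better e ev /= /dop /= truth_of_bool cc.
  apply: (trans c c1 d1); last exact: ltW.
  by rewrite /better e ev /= /dop /= truth_of_bool leNgt cc.
- have [ea|[c1 [d1 ea]]] := hv acc (or_introl erefl).
    by apply: (trans c c d) => //; rewrite /better e ea.
  case: (leP c1 c) => cc.
    by apply: (trans c c1 d1) => //; rewrite /better e ea /= /dop /= truth_of_bool cc.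
  by apply: (trans c c d) => //; rewrite /better e ea /= /dop /= truth_of_bool leNgt cc.
Qed.

Lemma sem_best O (I : jrp_data s) : sem O t_best [:: inst I] =
  foldl better Nil [seq sem O t_eval [:: enc_repl Q; Nil; inst I]
                   | Q <- candidates s (times tau I)].
Proof.
(* [t_eval] does not read the accumulator, so the candidates can be evaluated independently of the
   loop. *)
have nf acc Q : sem O t_eval [:: enc_repl Q; acc; inst I] =
    sem O t_eval [:: enc_repl Q; Nil; inst I].
  apply: (@sem_notfree _ _ 1); last by case=> [|[]].
  by rewrite /= !notfree_date.
have := sem_cands O I; rewrite /t_best; move: (TSnd _) => C hC.
move: t_eval nf => E nf.
rewrite -[LHS]/(foldl (fun acc it => better acc (sem O E [:: it; acc; inst I])) Nil
  (items (sem O C [:: inst I]))) hC /enc_cands items_enc.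
have key : forall (L : seq (replenishment s)) acc,
   foldl (fun acc it => better acc (sem O E [:: it; acc; inst I])) acc
     [seq enc_repl Q | Q <- L] =
   foldl better acc [seq sem O E [:: enc_repl Q; Nil; inst I] | Q <- L].
  move: {hC} (inst I) nf => e nf.
  by elim=> [|Q L IH] acc //=; rewrite nf IH.
exact: key.
Qed.

End Enumeration.

(** * The two reductions *)

Section JrpToClassical.

Variables (s tau : nat).

Local Notation inst I := (@enc_instance (jrp_problem s tau) I).

Definition cand_env : envpred := fun O env => exists (I : jrp_data s) Q acc,
  [/\ solves (classical_problem tau) O, valid_jrp tau I, Q \in candidates s (times tau I)
    & env = [:: enc_repl Q; acc; inst I]].

Lemma ptime_eval : ptime_on cand_env (t_eval s).
Proof.
(* Passing the feasibility test makes the query a valid classical instance, for which [wt_optimal]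
   bounds the answer. *)
pose feas_env : envpred := fun O env => exists (I : jrp_data s) Q acc,
  [/\ solves (classical_problem tau) O, valid_jrp tau I, Q \in candidates s (times tau I),
      [forall j, isSome (@induced_date s I Q j)] & env = [:: enc_repl Q; acc; inst I]].
apply: (@ptime_if _ feas_env anyenv) => //; last exact: ptime_const.
- by apply: ptime_feasible; exact: ptime_simple.
- move=> O _ [I [Q [acc [hO vI hQ ->]]]].
  rewrite (@sem_feasible s O I Q) // => hf.
  by exists I, Q, acc.
apply: (@ptime_let _ anyenv) => //; last first.
  apply: ptime_pair; last exact: ptime_simple.
  apply: ptime_op; last exact: ptime_repl_cost.
  by apply: ptime_dot => //; exact: ptime_simple.
apply: ptime_ask; first by apply: ptime_inst; exact: ptime_simple.
exists (fun n => 1 + n * (2 * n + 2))%N; first by polyb.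
move=> O _ [I [Q [acc [hO vI hQ hf ->]]]].
have vJ := induced_jobs_valid vI hQ hf.
rewrite (@sem_inst s O I Q) //.
have [S optS ->] := hO (induced_jobs I Q) vJ.
apply: (wt_optimal (J := induced_jobs I Q)) => //.
by move=> j; have [h _] := vJ; have [p0 _ w0] := h j.
Qed.

Definition inst_env : envpred := fun O env => exists I : jrp_data s,
  [/\ solves (classical_problem tau) O, valid_jrp tau I & env = [:: inst I]].

Lemma ptime_best : ptime_on inst_env (t_best s tau).
Proof.
have pe := ptime_eval.
apply: (@ptime_fold_inv _ cand_env (fun _ _ _ => True)) => //.
- by apply: ptime_snd; exact: ptime_cands.
- exact: ptime_const.
- move=> O _ acc it [I [hO vI ->]] _; rewrite sem_cands items_enc => hin; split=> //.
  have [Q hQ ->] : exists2 Q, Q \in candidates s (times tau I) & it = enc_repl Q.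
    elim: (candidates _ _) hin => //= Q L IH [<-|/IH[Q' hQ' ->]].
      by exists Q => //; rewrite inE eqxx.
    by exists Q' => //; rewrite inE hQ' orbT.
  by exists I, Q, acc.
(* The new accumulator is the old one or the value of [t_eval]. That value does not depend on the
   accumulator, and [n + 1] pays for the [Nil] put in its place. *)
- case: pe => p pp hp; exists (fun n => p (n + 1))%N; first by polyb.
  move=> O env acc it [I [Q [acc' [hO vI hQ [-> _ ->]]]]].
  set e := [:: _, _ & _].
  have nf : sem O (t_eval s) e = sem O (t_eval s) [:: enc_repl Q; Nil; inst I].
    apply: (@sem_notfree _ _ 1); last by case=> [|[]].
    by rewrite /= !notfree_date.
  have h : (wt (sem O (t_eval s) e) <= p (wt (enc_repl Q) + wenv [:: inst I] + 1))%N.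
    have -> : (wt (enc_repl Q) + wenv [:: inst I] + 1 =
       wenv [:: enc_repl Q; Nil; inst I])%N by rewrite !wenv_cons -[wt Nil]/1%N; lia.
    rewrite nf; apply: leq_trans (leq_addl _ _) (hp _ _ _).
    by exists I, Q, Nil.
  apply: leq_trans (_ : (wt acc + wt (sem O (t_eval s) e) <= _)%N); last by rewrite leq_add2l.
  move: (t_eval s) => E; rewrite [X in (wt X <= _)%N]/=.
  by do 3?[case: ifP => _]; lia.
- apply: (@ptime_let _ anyenv) => //; exact: ptime_simple.
Qed.

Lemma best_optimal O (I : jrp_data s) :
  solves (classical_problem tau) O -> valid_jrp tau I ->
  @encodes_optimal (jrp_problem s tau) I (sem O (TSnd (t_best s tau)) [:: inst I]).
Proof.
move=> hO vI; have [vJ hR K0 Ki] := vI.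
have [sT rT _] := timesP vJ.
pose cands := candidates s (times tau I).
pose ev (Q : replenishment s) := sem O (t_eval s) [:: enc_repl Q; Nil; inst I].
pose ok Q := [forall j, isSome (@induced_date s I Q j)].
have sQ Q : Q \in cands -> sorted <%R [seq y.2 | y <- Q] by exact: candidate_sorted.
have uT : uniq (rev (times tau I)).
  rewrite rev_uniq; apply: (sorted_uniq (rev_trans lt_trans)) sT => x; exact: ltxx.
have evP v : List.In v [seq ev Q | Q <- cands] <-> exists2 Q, Q \in cands & v = ev Q.
  elim: (cands) => [|Q L IH] /=; first by split=> // -[].
  split=> [[<-|/IH[Q' h ->]]|[Q' + e]].
  - by exists Q => //; rewrite inE eqxx.
  - by exists Q' => //; rewrite inE h orbT.
  - by rewrite inE => /orP[/eqP h|h]; [left; rewrite e h|right; apply/IH; exists Q'].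
have evok Q : Q \in cands -> ok Q -> exists2 S : schedule (induced_jobs I Q), sched_optimal S &
    ev Q = Pair (Num (\sum_(j < njobs I) weight j * S j + replenishment_cost I Q))
      (Pair (enc_fun (fun j => Num (S j))) (enc_repl Q)).
  by move=> hQ hf; apply: sem_eval.
have evno Q : ~~ ok Q -> ev Q = Nil by exact: sem_eval_infeasible.
have vals v : List.In v (Nil :: [seq ev Q | Q <- cands]) -> is_value v.
  case=> [<-|/evP[Q hQ ->]]; first by left.
  case: (boolP (ok Q)) => hf; last by left; apply: evno.
  by have [S _ ->] := evok Q hQ hf; right; do 2!eexists.
have [hin hmin] := foldl_better vals.
have okP Q (S : schedule I) : Q \in cands -> (forall j, ready Q j (S j)) ->
    ok Q /\ forall j, odflt 0 (induced_date Q j) <= S j.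
  move=> hQ hr; have h j := (induced_dateP (S j) (sQ _ hQ) (hR j)).1 (hr j).
  by split=> [|j]; [apply/forallP => j|]; have [u -> ?] := h j.
(* This candidate is feasible, so the selection cannot end with [Nil]. *)
pose Qall := @select s (rev (times tau I)) (fun=> Some setT).
have allin : Qall \in cands by exact: select_candidates.
have [allok _] := okP Qall (@rdate I) allin (select_ready vJ (fun j => lexx _)).
have [Sa _ eva] := evok _ allin allok.
have [c [d [er _]]] := hmin _ _ (or_intror ((evP _).2 (ex_intro2 _ _ Qall allin (esym eva)))).
rewrite er in hin; case: hin => // /evP[Q hQ eQ].
have okQ : ok Q by apply/negPn/negP => /evno h; rewrite h in eQ.
have [S [[noS relS] optS] eS] := evok Q hQ okQ.
rewrite eS in eQ; case: eQ => ec ed.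
exists (S, Q); last first.
  rewrite -[LHS]/(dsnd (sem O (t_best s tau) [:: inst I])) sem_best er /=.
  by rewrite ed.
split.
  split=> //=; first exact: sQ.
  move=> j; apply/(induced_dateP _ (sQ _ hQ) (hR j)).
  have := forallP okQ j; have := relS j; rewrite /=.
  by case: (induced_date Q j) => // u ? _; exists u.
move=> [S2 Q2] /= [noS2 _ readyS2].
have rT' j : @rdate I j \in rev (times tau I) by rewrite mem_rev.
(* The competitor is compared through its normalised structure [Q']: [S2] is feasible for the
   instance induced by [Q'], so it is no better than the schedule evaluated for [Q']. *)
have [A [readyA costA]] := normalise K0 Ki uT rT' readyS2.
set Q' := select _ _ in readyA costA.
have hQ' : Q' \in cands by exact: select_candidates.
have [okQ' relQ'] := okP Q' S2 hQ' readyA.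
have [S' [_ optS'] eS'] := evok Q' hQ' okQ'.
have [c1 [d1 [er1 le1]]] := hmin _ _ (or_intror ((evP _).2 (ex_intro2 _ _ Q' hQ' (esym eS')))).
rewrite er in er1; case: er1 => e1 _; rewrite -e1 ec in le1.
have feas2 : sched_feasible (J := induced_jobs I Q') S2 by split.
have := optS' S2 feas2.
(* Restores the constant left out by [t_eval]; it is common to all candidates because induced
   instances keep processing times and weights. *)
have wcE (U : schedule I) : weighted_completion U =
    \sum_(j < njobs I) weight j * U j + \sum_(j < njobs I) weight j * ptime j.
  by rewrite -big_split; apply: eq_bigr => j _ /=; rewrite /completion mulrDr.
rewrite -[weighted_completion S']/(weighted_completion (S' : schedule I)).
rewrite -[@weighted_completion (induced_jobs I Q') S2]/(weighted_completion (S2 : schedule I)).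
rewrite !wcE; move: le1 costA; lra.
Qed.

Theorem jrp_reduces_to_classical : poly_reducible (jrp_problem s tau) (classical_problem tau).
Proof.
apply: (@poly_reducible_prog _ _ (TSnd (t_best s tau)) inst_env).
- by move=> O I hO vI; exists I.
- by apply: ptime_snd; exact: ptime_best.
- exact: best_optimal.
Qed.

End JrpToClassical.

Section ClassicalToJrp.

Variables (s tau : nat) (hs : (0 < s)%N).

Definition free_jrp (J : jobs) : jrp_data s := @JrpData s J (fun=> setT) 0 (fun=> 0).

Definition t_free : tm :=
  TPair
    (t_map (TVar 0) (TPair (TFst (TVar 0)) (TPair (t_job_date 0) (TPair (t_job_weight 0)
       (TPair (TConst (enc_set [set: 'I_s])) (TConst Nil))))))
    (TConst (Pair (Num 0) (enc_fun (fun i : 'I_s => Num 0)))).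

Lemma sem_free O (J : jobs) :
  sem O t_free [:: @enc_instance (classical_problem tau) J] =
  @enc_instance (jrp_problem s tau) (free_jrp J).
Proof.
rewrite /t_free; set M := t_map _ _.
rewrite -[LHS]/(Pair (sem O M [:: @enc_instance (classical_problem tau) J]) _) /M.
rewrite (@sem_map O _ _ _ (fun d => Pair (dfst d) (Pair (dfst (dsnd d))
   (Pair (dfst (dsnd (dsnd d))) (Pair (enc_set [set: 'I_s]) Nil))))) //.
by rewrite /= /enc_fun items_enc -map_comp.
Qed.

Lemma ptime_free P : ptime_on P t_free.
Proof.
apply: ptime_pair; last exact: ptime_const.
by apply: ptime_map => //; exact: ptime_simple.
Qed.

Lemma free_jrp_valid (J : jobs) : valid_jobs tau J -> valid_jrp tau (free_jrp J).
Proof.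
move=> vJ; split=> //= j; apply/set0Pn; by exists (Ordinal hs).
Qed.

(** Readiness for a nonempty set, available since [0 < s], gives [r_j <= S_j]. Conversely every
    classical schedule is completed at no cost by replenishing everything at every release date, so
    the objectives can be compared directly. *)
Lemma free_jrp_optimal (J : jobs) (x : @solution (jrp_problem s tau) (free_jrp J)) :
  valid_jobs tau J -> optimal x -> sched_optimal (J := J) x.1.
Proof.
move=> vJ [[noS sQ rdy] opt].
have cost_free Q : replenishment_cost (free_jrp J) Q = 0.
  by apply: big1 => y _; rewrite add0r; apply: big1.
split.
  split=> // j; have /subsetP/(_ (Ordinal hs) (in_setT _))/in_bigcup_seq := rdy j.
  by case=> y [_ /andP[h1 h2] _]; apply: le_trans h2.
move=> S' [noS' relS'].
have [sT _ _] := timesP vJ.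
pose Q' := @select s (rev (times tau J)) (fun=> Some setT).
have := opt (S', Q'); rewrite /= !cost_free !addr0; apply; split=> //=.
- by rewrite map_snd_select; apply: (sorted_filter lt_trans); rewrite rev_sorted.
- exact: (@select_ready s tau (free_jrp J)).
Qed.

(** [wt_optimal] bounds the schedule by the weight of the classical instance, while [ptime_fst_ask]
    wants a bound in the weight of the query. *)
Lemma wt_free_jrp (J : jobs) :
  (wt (@enc_instance (classical_problem tau) J) <=
   wt (@enc_instance (jrp_problem s tau) (free_jrp J)))%N.
Proof.
rewrite /= !wt_enc_fun /=.
apply: leqW; apply: leq_trans (leq_addr _ _); rewrite leq_add2l.
by apply: leq_sum => j _ /=; lia.
Qed.

Theorem classical_reduces_to_jrp : poly_reducible (classical_problem tau) (jrp_problem s tau).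
Proof.
pose P : envpred := fun O env => exists J, [/\ solves (jrp_problem s tau) O, valid_jobs tau J
  & env = [:: @enc_instance (classical_problem tau) J]].
have ans O J : solves (jrp_problem s tau) O -> valid_jobs tau J ->
  exists2 S : schedule J, sched_optimal S &
    dfst (O (@enc_instance (jrp_problem s tau) (free_jrp J))) = enc_fun (fun j => Num (S j)).
  move=> hO vJ; have [x ox ->] := hO _ (free_jrp_valid vJ).
  by exists x.1 => //; apply: free_jrp_optimal.
apply: (@poly_reducible_prog _ _ (TFst (TAsk t_free)) P).
- by move=> O J hO vJ; exists J.
- apply: ptime_fst_ask; first exact: ptime_free.
  exists (fun n => 1 + n * (2 * n + 2))%N; first by polyb.
  move=> O _ [J [hO vJ ->]]; rewrite sem_free.
  have [S oS ->] := ans O J hO vJ.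
  have pos : forall j, 0 < @ptime J j /\ 0 < @weight J j.
    by move=> j; have [h _] := vJ; have [? _ ?] := h j.
  apply: leq_trans (wt_optimal pos oS erefl) _.
  have := wt_free_jrp J; set a := wt _; set b := wt _ => ab.
  by rewrite leq_add2l leq_mul // leq_add2r leq_mul2l ab orbT.
- move=> O J hO vJ.
  rewrite -[sem _ _ _]/(dfst (O (sem O t_free [:: @enc_instance (classical_problem tau) J]))).
  by rewrite sem_free; have [S oS ->] := ans O J hO vJ; exists S.
Qed.

End ClassicalToJrp.

Theorem theorem1 (s tau : nat) (hs : (0 < s)%N) :
  equivalent (jrp_problem s tau) (classical_problem tau).
Proof.
by split; [exact: jrp_reduces_to_classical|exact: classical_reduces_to_jrp].
Qed.
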